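(* Let $T\ge1$, let $\{f_n\}_{n\ge1}$ and $\{g_n\}_{n\ge1}$ be sequences of probability densities that are periodic with period $T$ ($f_{n+T}=f_n$, $g_{n+T}=g_n$ for all $n\ge 1$), and let $$I=\frac1T\sum_{i=1}^T D(g_i\,\|\,f_i)$$ satisfy $0<I<\infty$. Then, for any stopping time $\tau$ satisfying the false alarm constraint $\mathsf{E}_\infty[\tau]\ge\beta$, we have as $\beta\to\infty$ $$\sup_{\nu\geq 1} \, \operatorname{ess\,sup}\, \mathsf{E}_{\nu} [\tau - \nu \mid X_1, \cdots, X_{\nu-1}] \;\geq\; \sup_{\nu\geq 1} \, \mathsf{E}_{\nu} [\tau - \nu \mid \tau \geq \nu] \;\geq\; \frac{\log \beta}{I} (1 + o(1)),$$ where the $o(1)$ term goes to zero in the limit as $\beta\to\infty$.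
   Context: Change point model: for $\nu\ge 1$, $\mathsf{P}_\nu$ denotes the law of the process $\{X_n\}_{n\ge1}$ of independent random variables such that $X_n$ has density $f_n$ for $n<\nu$ and density $g_n$ for $n\ge\nu$ (change at time $\nu$), with corresponding expectation $\mathsf{E}_\nu$. $\mathsf{P}_\infty,\mathsf{E}_\infty$ correspond to no change ($X_n\sim f_n$ for all $n$). Stopping times are with respect to the filtration generated by the observations $\{X_n\}$. $D(g\,\|\,f)$ is the Kullback-Leibler divergence between densities $g$ and $f$, i.e. $\int g\log(g/f)$. It is assumed that $D(g_i\,\|\,f_i)<\infty$ for all $i=1,\dots,T$ and $D(g_i\,\|\,f_i)>0$ for some $i$. The essential supremum $\operatorname{ess\,sup}$ of $\mathsf{E}_\nu[\tau-\nu\mid X_1,\dots,X_{\nu-1}]$ is its supremum as a random variable outside a set of $\mathsf{P}_\nu$-measure zero. Conditional expectations given $\{\tau\ge\nu\}$ are considered only for those $\nu$ for which this event has positive probability. *)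

(* Defs.v *)
From HB Require Import structures.
From mathcomp Require Import all_boot all_order all_algebra.
From mathcomp Require Import all_classical all_reals all_analysis.
From mathcomp Require Import measurable_realfun ess_sup_inf.

Set Implicit Arguments.
Unset Strict Implicit.
Unset Printing Implicit Defensive.

Import Order.TTheory GRing.Theory Num.Theory.
Import numFieldNormedType.Exports.

Local Open Scope classical_set_scope.
Local Open Scope ring_scope.
Local Open Scope ereal_scope.

(* Observations X_n, densities f_n, g_n and change points nu are indexed from 1
   as in X_1, X_2, ...; the value of a sequence at index 0 is never used.
   Densities are taken with respect to an arbitrary sigma-finite reference
   measure mu on an arbitrary observation space E (Lebesgue measure on the line
   and counting measures are instances). *)

Section densities.
Context d (E : measurableType d) (R : realType).
Variable mu : {sigma_finite_measure set E -> \bar R}.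

Definition is_density (h : E -> R) : Prop :=
  [/\ measurable_fun setT h, forall x, (0 <= h x)%R
    & \int[mu]_x (h x)%:E = 1].

(* The product, quotient and logarithm are those of \bar R, so the integrand is
   0 where g vanishes (0 * -oo = 0) and +oo where g > 0 = f (1 / 0 = +oo). *)
Definition KL (g f : E -> R) : \bar R :=
  \int[mu]_x ((g x)%:E * lne ((g x)%:E / (f x)%:E)).

Definition info_rate (T : nat) (f g : nat -> E -> R) : \bar R :=
  (T%:R^-1)%:E * \sum_(1 <= i < T.+1) KL (g i) (f i).

End densities.

Definition periodic_from1 (A : Type) (T : nat) (h : nat -> A) : Prop :=
  forall n, (1 <= n)%N -> h (n + T)%N = h n.

Section change_point_model.
Context d (E : measurableType d) d' (Omega : measurableType d') (R : realType).
Variable mu : {sigma_finite_measure set E -> \bar R}.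
Variable X : nat -> {mfun Omega >-> E}.

Definition independent_process (P : probability Omega R) : Prop :=
  forall (s : seq nat) (B : nat -> set E),
    uniq s -> (forall n, n \in s -> (1 <= n)%N) ->
    (forall n, measurable (B n)) ->
    P (\bigcap_(n in [set` s]) (X n @^-1` B n)) =
    \prod_(n <- s) P (X n @^-1` B n).

Definition independent_with_densities (P : probability Omega R)
    (h : nat -> E -> R) : Prop :=
  independent_process P /\
  forall n, (1 <= n)%N -> forall B, measurable B ->
    P (X n @^-1` B) = \int[mu]_(x in B) (h n x)%:E.

Definition change_point_model (f g : nat -> E -> R)
    (Pinf : probability Omega R) (P : nat -> probability Omega R) : Prop :=
  independent_with_densities Pinf f /\
  forall nu, (1 <= nu)%N ->
    independent_with_densities (P nu)
      (fun n => if (n < nu)%N then f n else g n).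

(* sigma(X_1, ..., X_n); trivial for n = 0. *)
Definition obs_filtration (n : nat) : set (set Omega) :=
  g_sigma_preimage (fun i : 'I_n => X i.+1 : Omega -> E).

(* Random times take values in {0, 1, 2, ...} together with None = infinity. *)
Definition time_val (t : option nat) : \bar R :=
  if t is Some n then n%:R%:E else +oo.

Definition stopping_time (tau : Omega -> option nat) : Prop :=
  forall n, obs_filtration n [set w | time_val (tau w) <= n%:R%:E].

(* Y is a version of E[Z | G], for Z whose negative part is integrable. *)
Definition is_cond_expectation (P : probability Omega R)
    (G : set (set Omega)) (Z Y : Omega -> \bar R) : Prop :=
  preimage_set_system setT Y measurable `<=` G /\
  forall A, G A -> \int[P]_(w in A) Y w = \int[P]_(w in A) Z w.

(* A chosen version; the default cst 0 plays no role when Z is bounded below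
   and measurable, since a version then exists. *)
Definition cond_expectation (P : probability Omega R)
    (G : set (set Omega)) (Z : Omega -> \bar R) : Omega -> \bar R :=
  xget (cst 0) [set Y | is_cond_expectation P G Z Y].

Definition cond_expectation_event (P : probability Omega R)
    (A : set Omega) (Z : Omega -> \bar R) : \bar R :=
  (\int[P]_(w in A) Z w) / P A.

Definition delay (tau : Omega -> option nat) (nu : nat) : Omega -> \bar R :=
  fun w => time_val (tau w) - nu%:R%:E.

Definition not_before (tau : Omega -> option nat) (nu : nat) : set Omega :=
  [set w | nu%:R%:E <= time_val (tau w)].

(* sup over nu >= 1 of ess sup E_nu[tau - nu | X_1, ..., X_{nu-1}] *)
Definition worst_ess_sup_delay (P : nat -> probability Omega R)
    (tau : Omega -> option nat) : \bar R :=
  ereal_sup [set ess_sup (P nu)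
                   (cond_expectation (P nu) (obs_filtration nu.-1)
                      (delay tau nu))
            | nu in [set nu | (1 <= nu)%N]].

(* sup over nu >= 1 of E_nu[tau - nu | tau >= nu] *)
Definition worst_cond_delay (P : nat -> probability Omega R)
    (tau : Omega -> option nat) : \bar R :=
  ereal_sup [set cond_expectation_event (P nu) (not_before tau nu)
                   (delay tau nu)
            | nu in [set nu | (1 <= nu)%N /\ 0 < P nu (not_before tau nu)]].

End change_point_model.

Arguments time_val {R} t.
Arguments stopping_time {d E d' Omega} R X tau.

(* Main.v *)
Require Import Defs.
From HB Require Import structures.
From mathcomp Require Import all_boot all_order all_algebra.
From mathcomp Require Import all_classical all_reals all_analysis.
From mathcomp Require Import measurable_realfun ess_sup_inf.
From mathcomp Require Import ring lra zify.
Import Order.TTheory GRing.Theory Num.Theory.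
Import numFieldNormedType.Exports.
Set Implicit Arguments.
Unset Strict Implicit.
Unset Printing Implicit Defensive.
Local Open Scope classical_set_scope.
Local Open Scope ring_scope.

(** The proof is an information-theoretic change-of-measure argument.

    Let tau be a stopping time whose mean is at least beta when no change
    occurs, and let q_k and p_k be the probabilities of {tau >= k} under P nu
    and Pinf.  As the p_k have a large sum, they cannot decay fast everywhere:
    for every window length M there is some nu such that, under Pinf, tau falls
    in [nu, nu + M) with conditional probability at most 2 M / beta given
    {tau >= nu} ([exists_slow_decay]).  The change point is put at this nu.  The
    event {tau >= nu} depends on X_1, ..., X_(nu-1) alone, which have the same
    law under P nu and Pinf ([eq_before_change]); hence p_nu = q_nu.

    Consider the log-likelihood ratio L of the observations from nu up to tau or
    to the end of the window, whichever comes first.  As {tau >= k} is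
    independent of X_k, its mean under P nu is the sum of D(g_k || f_k) q_k over
    the window, as in Wald's identity.  This mean is bounded from below by
    integrating L >= 1 + c - exp (c - L) and using that the integral of exp (- L)
    over an event is at most the probability of this event under Pinf
    ([stopped_information_ge]).  The outcome is the data processing inequality
    for the event that tau falls in the window, in a form that is linear in the
    probabilities: an event of probability near 1 under P nu and at most
    2 M / beta under Pinf costs an information of about log (beta / M).

    By periodicity the information grows at rate I, up to the contribution of
    one period ([periodic_sum_le]).  So the sum of the q_k over the window, which
    is at most the integral of tau - nu over {tau >= nu} ([integral_delay_ge]),
    is at least (1 + o(1)) log beta / I times q_nu.  In terms of
    y = sqrt (log beta), windows of length about T y^3 and c = y^2 - 4 y make the
    error explicit ([delay_arith], [rate_error]).

    The first inequality holds for each nu separately: {tau >= nu} belongs to the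
    sigma-algebra of X_1, ..., X_(nu-1), so that E_nu [tau - nu | tau >= nu] is
    an average of the conditional expectation over this event
    ([cond_delay_le_ess_sup]). *)

(** * The sigma-algebras of the observations *)

Section observations.
Context {d} {E : measurableType d} {d'} {Omega : measurableType d'}.
Variable X : nat -> {mfun Omega >-> E}.

Lemma measurable_obs k B : measurable B -> measurable (X k @^-1` B).
Proof. by move=> mB; rewrite -(setTI (_ @^-1` _)); exact: measurable_funP. Qed.

Lemma obs_filtration_obs n k B : measurable B -> (1 <= k <= n)%N ->
  obs_filtration X n (X k @^-1` B).
Proof.
move=> mB /andP[k0 kn]; rewrite /obs_filtration /g_sigma_preimage; apply: sub_sigma_algebra.
have kn' : (k.-1 < n)%N by rewrite prednK.
rewrite -bigcup_seq; exists (Ordinal kn') => /=; first exact: mem_index_enum.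
by exists B => //; rewrite setTI prednK.
Qed.

Lemma obs_filtration_min n (S : set (set Omega)) : sigma_algebra setT S ->
  (forall k B, measurable B -> (1 <= k <= n)%N -> S (X k @^-1` B)) ->
  obs_filtration X n `<=` S.
Proof.
move=> salgS XS; rewrite /obs_filtration /g_sigma_preimage.
apply: smallest_sub; first by [].
move=> A; rewrite -bigcup_seq => -[i /= _].
by move=> [B mB <-]; rewrite setTI; apply: XS; rewrite //= ltn_ord.
Qed.

Lemma obs_filtrationT n : obs_filtration X n setT.
Proof.
rewrite -setC0; apply: (@sigma_algebraC _ (\big[setU/set0]_(i < n) _)).
exact: sigma_algebra0.
Qed.

Lemma obs_filtrationC n A : obs_filtration X n A -> obs_filtration X n (~` A).
Proof. exact: (@sigma_algebraC _ (\big[setU/set0]_(i < n) _)). Qed.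

Lemma obs_filtrationI n A B : obs_filtration X n A -> obs_filtration X n B ->
  obs_filtration X n (A `&` B).
Proof.
move=> FA FB; rewrite -(setCK A) -(setCK B) -setCU; apply: obs_filtrationC.
rewrite -bigcup2E; apply: sigma_algebra_bigcup => -[|[|i]] /=.
- exact: obs_filtrationC FA.
- exact: obs_filtrationC FB.
- exact: sigma_algebra0.
Qed.

Lemma sub_obs_filtration n m : (n <= m)%N ->
  obs_filtration X n `<=` obs_filtration X m.
Proof.
move=> nm; apply: obs_filtration_min => [|k B mB /andP[k0 kn]].
  exact: smallest_sigma_algebra.
by apply: obs_filtration_obs => //; rewrite k0 (leq_trans kn).
Qed.

Lemma obs_filtration_measurable n : obs_filtration X n `<=` measurable.
Proof.
apply: obs_filtration_min => [|k B mB _]; first exact: sigma_algebra_measurable.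
exact: measurable_obs.
Qed.

Definition cylinder (n : nat) (B : nat -> set E) : set Omega :=
  \bigcap_(k in [set k | (1 <= k <= n)%N]) X k @^-1` B k.

Definition cylinders (n : nat) : set (set Omega) :=
  [set cylinder n B | B in [set B | forall k, measurable (B k)]].

Lemma cylinderS n B : cylinder n.+1 B = cylinder n B `&` X n.+1 @^-1` B n.+1.
Proof.
apply/seteqP; split=> [w Bw|w [Bw Bnw] k /= /andP[k0]].
  split=> [k /= /andP[k0 kn]|]; last by apply: Bw; rewrite /= leqnn.
  by apply: Bw; rewrite /= k0 leqW.
rewrite leq_eqVlt => /predU1P[->//|kn].
by apply: Bw; rewrite /= k0.
Qed.

Lemma cylinder_iota n B :
  cylinder n B = \bigcap_(k in [set` iota 1 n]) X k @^-1` B k.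
Proof.
by congr bigcap; apply/funext => k; rewrite /= mem_iota add1n ltnS.
Qed.

Lemma cylinderI n B C :
  cylinder n B `&` cylinder n C = cylinder n (fun k => B k `&` C k).
Proof. by rewrite /cylinder -bigcapI. Qed.

Lemma cylinders_setI n : setI_closed (cylinders n).
Proof.
move=> _ _ [B mB <-] [C mC <-]; rewrite cylinderI.
by exists (fun k => B k `&` C k) => // k; apply: measurableI.
Qed.

Lemma cylinders_setT n : cylinders n setT.
Proof.
by exists (fun=> setT) => //; apply/seteqP; split.
Qed.

Lemma cylinders_obs_filtration n m : (n <= m)%N ->
  cylinders n `<=` obs_filtration X m.
Proof.
move=> + _ [B mB <-]; elim: n => [_|n IHn nm].
  rewrite (_ : cylinder _ _ = setT); last first.
    by apply/seteqP; split=> // w _ k /= /andP[k0]; rewrite leqNgt k0.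
  exact: obs_filtrationT.
rewrite cylinderS; apply: obs_filtrationI; first exact: IHn (ltnW nm).
exact: obs_filtration_obs.
Qed.

Lemma obs_filtration_cylinders n : obs_filtration X n `<=` <<s cylinders n >>.
Proof.
apply: obs_filtration_min; first exact: smallest_sigma_algebra.
move=> k B mB kn; apply: sub_sigma_algebra.
exists (fun i => if i == k then B else setT) => [i|]; first by case: ifP.
apply/seteqP; split=> [w /(_ k)/=|w Bw i _]; last by rewrite /preimage/=; case: ifP => // /eqP ->.
by rewrite /preimage/= eqxx; apply.
Qed.

(** Cylinders form a pi-system that generates the filtration.  Identities between
    laws of the observations are reduced to cylinders in this way. *)
Lemma eq_measure_obs_filtration (R : realType) n
    (m1 m2 : {measure set Omega -> \bar R}) :
  (forall B, (forall k, measurable (B k)) ->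
    m1 (cylinder n B) = m2 (cylinder n B)) ->
  (m1 setT < +oo)%E -> forall A, obs_filtration X n A -> m1 A = m2 A.
Proof.
move=> m12 m1fin A /obs_filtration_cylinders.
apply: (g_sigma_algebra_measure_unique (cylinders n) _ (fun=> setT)) => //.
- by move=> B /(cylinders_obs_filtration (leqnn n))/obs_filtration_measurable.
- by move=> _; exact: cylinders_setT.
- by rewrite bigcup_const.
- exact: cylinders_setI.
- by move=> _ [B mB <-]; exact: m12.
Qed.

End observations.

Section independence.
Context {d} {E : measurableType d} {d'} {Omega : measurableType d'} {R : realType}.
Variables (X : nat -> {mfun Omega >-> E}) (Q : probability Omega R).
Hypothesis indX : independent_process X Q.
Local Open Scope ereal_scope.

(** For fixed B both sides are finite measures in A, and they agree on cylinders by
    the product formula. *)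
Lemma independent_past n k A B : obs_filtration X n A -> (n < k)%N ->
  measurable B -> Q (A `&` X k @^-1` B) = Q A * Q (X k @^-1` B).
Proof.
move=> FA nk mB; have mXB := measurable_obs X k mB.
have QXB : Q (X k @^-1` B) \is a fin_num by exact: fin_num_measure.
pose r : {nonneg R} := NngNum (fine_ge0 (measure_ge0 Q (X k @^-1` B))).
rewrite -[LHS]/(mrestr Q mXB A) muleC -[Q (_ @^-1` _)]fineK//.
rewrite -[RHS]/(mscale r Q A); apply: (eq_measure_obs_filtration _ _ FA).
  move=> C mC; rewrite /= /mrestr /mscale /= fineK//.
  have kn : k \notin iota 1 n by rewrite mem_iota add1n ltnS [(k <= n)%N]leqNgt nk andbF.
  pose D i := if i == k then B else C i.
  have DC i : i \in iota 1 n -> D i = C i.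
    by rewrite /D; case: eqP => // ->; rewrite (negbTE kn).
  rewrite cylinder_iota.
  have -> : \bigcap_(i in [set` iota 1 n]) X i @^-1` C i `&` X k @^-1` B =
      \bigcap_(i in [set` k :: iota 1 n]) X i @^-1` D i.
    apply/seteqP; split=> [w [Cw Bw] i /=|w Dw].
      rewrite inE => /predU1P[->|ni]; first by rewrite /D eqxx.
      by rewrite DC//; exact: Cw.
    split=> [i ni|]; first by rewrite -DC//; apply: Dw; rewrite /= inE ni orbT.
    by have := Dw k; rewrite /= mem_head /D eqxx; exact.
  rewrite indX; last 3 first.
  - by rewrite /= kn iota_uniq.
  - by move=> i; rewrite inE => /predU1P[->|]; [exact: leq_trans nk|rewrite mem_iota => /andP[]].
  - by move=> i; rewrite /D; case: ifP.
  rewrite big_cons {1}/D eqxx; congr (_ * _).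
  rewrite indX ?iota_uniq//; last by move=> i; rewrite mem_iota => /andP[].
  by apply: eq_big_seq => i ni; rewrite DC.
by rewrite /= /mrestr setTI (le_lt_trans (probability_le1 _ _)) ?ltry.
Qed.

End independence.

(** * Integrals of products of independent functions *)

Section independent_integrals.
Context {d} {Omega : measurableType d} {R : realType} (Q : probability Omega R).
Local Open Scope ereal_scope.

(** The joint law of Y and Z is the product of their laws, so Tonelli's theorem
    separates the two functions. *)
Lemma ge0_integralM_indep d1 (T1 : measurableType d1) d2 (T2 : measurableType d2)
    (Y : {mfun Omega >-> T1}) (Z : {mfun Omega >-> T2})
    (u : T1 -> \bar R) (v : T2 -> \bar R) :
  (forall A B, measurable A -> measurable B ->
    Q (Y @^-1` A `&` Z @^-1` B) = Q (Y @^-1` A) * Q (Z @^-1` B)) ->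
  measurable_fun setT u -> (forall x, 0 <= u x) ->
  measurable_fun setT v -> (forall x, 0 <= v x) ->
  \int[Q]_w (u (Y w) * v (Z w)) = \int[Q]_w u (Y w) * \int[Q]_w v (Z w).
Proof.
move=> indep mu u0 mv v0.
pose J w := (Y w, Z w).
have mJ : measurable_fun setT J by apply: measurable_fun_pair.
pose uv (p : T1 * T2) := u p.1 * v p.2.
have muv : measurable_fun setT uv.
  by apply: emeasurable_funM; apply: measurableT_comp.
have uv0 p : 0 <= uv p by exact: mule_ge0.
pose JR : {mfun Omega >-> (T1 * T2)%type} := HB.pack J (isMeasurableFun.Build _ _ _ _ J mJ).
transitivity (\int[distribution Q JR]_p uv p).
  by rewrite ge0_integral_distribution.
transitivity (\int[distribution Q Y \x distribution Q Z]_p uv p).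
  apply: eq_measure_integral => A mA _; apply/esym.
  exact: product_measure_unique.
rewrite fubini_tonelli1// /fubini_F /uv/=.
under eq_integral do rewrite ge0_integralZl//.
rewrite ge0_integralZr//; last exact: integral_ge0.
by rewrite !ge0_integral_distribution.
Qed.

End independent_integrals.

Section past.
Context {d} {E : measurableType d} {d'} {Omega : measurableType d'} {R : realType}.
Variables (X : nat -> {mfun Omega >-> E}).
Local Open Scope ereal_scope.

(** The sample space carrying the sigma-algebra of the first n observations only:
    being adapted becomes plain measurability on this type. *)
Definition past (n : nat) := g_sigma_algebraType
  (\big[setU/set0]_(i < n) preimage_set_system setT (X i.+1) measurable).

Lemma measurable_past_obs n k : (1 <= k <= n)%N ->
  measurable_fun setT (X k : past n -> E).
Proof. by move=> kn _ B mB; rewrite setTI; apply: obs_filtration_obs. Qed.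

Lemma measurable_to_past n : measurable_fun setT (id : Omega -> past n).
Proof. by move=> _ A FA; rewrite setTI; exact: obs_filtration_measurable FA. Qed.

Lemma measurable_fun_past d1 (T : measurableType d1) n (u : Omega -> T) :
  measurable_fun setT (u : past n -> T) -> measurable_fun setT u.
Proof.
move=> mu _ B mB; apply: (@obs_filtration_measurable _ _ _ _ X n).
exact: mu.
Qed.

Variable (Q : probability Omega R).
Hypothesis indX : independent_process X Q.

Lemma ge0_integralM_past n k (u : past n -> \bar R) (v : E -> \bar R) :
  (n < k)%N -> measurable_fun setT u -> (forall x, 0 <= u x) ->
  measurable_fun setT v -> (forall x, 0 <= v x) ->
  \int[Q]_w (u w * v (X k w)) = \int[Q]_w u w * \int[Q]_w v (X k w).
Proof.
move=> nk mu u0 mv v0.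
pose Y : {mfun Omega >-> past n} :=
  HB.pack (id : Omega -> past n)
    (isMeasurableFun.Build _ _ _ _ _ (@measurable_to_past n)).
apply: (@ge0_integralM_indep _ _ _ Q _ _ _ _ Y (X k)) => // A B FA mB.
exact: (independent_past indX FA nk mB).
Qed.

Lemma measurable_prod_past n (h : nat -> E -> R) :
  (forall k, measurable_fun setT (h k)) ->
  measurable_fun setT
    ((fun w => \prod_(1 <= k < n.+1) h k (X k w))%R : past n -> R).
Proof.
move=> mh; apply: measurable_prod => k; rewrite mem_index_iota ltnS => kn.
by apply: measurableT_comp => //; exact: measurable_past_obs.
Qed.

Lemma integral_prod_obs n (h : nat -> E -> R) :
  (forall k, measurable_fun setT (h k)) -> (forall k x, 0 <= h k x)%R ->
  \int[Q]_w (\prod_(1 <= k < n.+1) h k (X k w))%:E =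
  \prod_(1 <= k < n.+1) \int[Q]_w (h k (X k w))%:E.
Proof.
move=> mh h0; elim: n => [|n IHn].
  under eq_integral do rewrite big_nil.
  by rewrite big_nil integral_cst//= mul1e; exact: probability_setT.
under eq_integral do rewrite big_nat_recr//= EFinM.
rewrite [RHS]big_nat_recr//= -IHn.
apply: (@ge0_integralM_past n n.+1
  (fun w => (\prod_(1 <= k < n.+1) h k (X k w))%:E) (EFin \o h n.+1)) => //.
- by apply/measurable_EFinP; exact: measurable_prod_past.
- by move=> w; rewrite lee_fin prodr_ge0.
- exact/measurable_EFinP.
- by move=> x; rewrite lee_fin.
Qed.

End past.

(** * Densities and log-likelihood ratios *)

Section integral_density.
Context {d} {E : measurableType d} {R : realType}.
Variables (mu : {sigma_finite_measure set E -> \bar R}) (g : E -> R).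
Hypothesis dg : is_density mu g.
Variable nu : {finite_measure set E -> \bar R}.
Local Open Scope ereal_scope.
Hypothesis nuE : forall B, measurable B -> nu B = \int[mu]_(x in B) (g x)%:E.

Lemma density_integrable : mu.-integrable setT (EFin \o g).
Proof.
case: dg => mg g0 g1; apply/integrableP; split; first exact/measurable_EFinP.
by under eq_integral do rewrite /= ger0_norm//; rewrite g1 ltry.
Qed.

(** The formula holds for the Radon-Nikodym derivative of nu, which agrees with g
    almost everywhere since both have the same integral over every set. *)
Lemma ge0_integral_density (h : E -> \bar R) : measurable_fun setT h ->
  (forall x, 0 <= h x) -> \int[nu]_x h x = \int[mu]_x (h x * (g x)%:E).
Proof.
move=> mh h0; case: dg => mg g0 g1.
have numu : nu `<< mu.
  apply/null_content_dominatesP => B mB B0; rewrite nuE//.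
  apply: null_set_integral => //.
  by apply: measurable_funTS; exact/measurable_EFinP.
rewrite -(Radon_Nikodym_SigmaFinite.change_of_variables numu)//.
have fint := Radon_Nikodym_SigmaFinite.f_integrable numu.
apply: ae_eq_integral => //.
- by apply: emeasurable_funM => //; exact: measurable_int fint.
- by apply: emeasurable_funM => //; exact/measurable_EFinP.
- apply: ae_eqe_mul2l; apply: integral_ae_eq => //; first exact/measurable_EFinP.
  move=> B _ mB.
  by rewrite -nuE// -Radon_Nikodym_SigmaFinite.f_integral.
Qed.

(** Positive and negative parts are transported separately, which covers infinite
    integrals as well. *)
Lemma integral_density (h : E -> \bar R) : measurable_fun setT h ->
  \int[nu]_x h x = \int[mu]_x (h x * (g x)%:E).
Proof.
move=> mh; case: dg => mg g0 g1.
rewrite [LHS]integralE [RHS]integralE; congr (_ - _).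
  rewrite ge0_integral_density//; last exact: measurable_funepos.
  apply: eq_integral => x _; rewrite !funeposE maxe_pMl ?lee_fin//.
  by rewrite mul0e.
rewrite ge0_integral_density//; last exact: measurable_funeneg.
apply: eq_integral => x _; rewrite !funenegE maxe_pMl ?lee_fin//.
by rewrite mul0e mulNe.
Qed.

Lemma integrable_density (h : E -> \bar R) : measurable_fun setT h ->
  mu.-integrable setT (fun x => h x * (g x)%:E) -> nu.-integrable setT h.
Proof.
move=> mh /integrableP[_ hg]; apply/integrableP; split => //.
rewrite ge0_integral_density//; last exact: measurableT_comp.
rewrite (eq_integral (fun x => `|h x * (g x)%:E|))// => x _.
by case: dg => _ g0 _; rewrite abseM (gee0_abs (x := (g x)%:E)) ?lee_fin.
Qed.

End integral_density.

Lemma measurable_gt0 {d} {E : measurableType d} {R : realType} (g : E -> R) :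
  measurable_fun setT g -> measurable [set x | (0 < g x)%R].
Proof.
move=> mg.
have := @measurable_fun_ltr _ _ _ setT (cst 0%R) g (measurable_cst _) mg.
by move=> /(_ measurableT [set true]); rewrite setTI; exact.
Qed.

Section log_likelihood_ratio.
Context {d} {E : measurableType d} {R : realType}.

(** The value 0 where a density vanishes keeps the ratio real and its exponential
    positive.  It does not affect expectations under g: the set where g = 0 is null
    for g, and so is the set where f = 0 once the divergence is finite. *)
Definition llr (f g : E -> R) (x : E) : R :=
  if (0 < f x) && (0 < g x) then ln (g x) - ln (f x) else 0.

Variables (mu : {sigma_finite_measure set E -> \bar R}) (f g : E -> R).
Hypotheses (df : is_density mu f) (dg : is_density mu g).

Lemma measurable_llr : measurable_fun setT (llr f g).
Proof.
case: df dg => mf _ _ [mg _ _]; apply: measurable_fun_ifT.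
- by apply: measurable_and; apply: measurable_fun_ltr.
- by apply: measurable_funB; apply: (measurableT_comp (@measurable_ln R)).
- exact: measurable_cst.
Qed.

Lemma expR_llr x : 0 < f x -> 0 < g x -> expR (- llr f g x) * g x = f x.
Proof.
move=> fx gx; rewrite /llr fx gx/= opprB expRD expRN !lnK ?posrE// mulfVK//.
by rewrite gt_eqF.
Qed.

Local Open Scope ereal_scope.

Let kl x := (g x)%:E * lne ((g x)%:E / (f x)%:E).

Let klE x : kl x = if (0 < g x)%R then
  if (0 < f x)%R then (llr f g x * g x)%:E else +oo else 0.
Proof.
case: df dg => _ f0 _ [_ g0 _]; rewrite /kl /llr.
have [gx|] := ltrP 0%R (g x); last first.
  by move=> gx; rewrite (_ : g x = 0%R) ?mul0e//; apply/eqP; rewrite eq_le gx g0.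
have [fx|fx] := ltrP 0%R (f x).
  rewrite inver gt_eqF// -EFinM lne_EFin ?divr_gt0// ln_div ?posrE//.
  by rewrite -EFinM mulrC.
rewrite inver (_ : f x = 0%R) ?eqxx ?gt0_muley ?lte_fin//.
by apply/eqP; rewrite eq_le fx f0.
Qed.

Let mkl : measurable_fun setT kl.
Proof.
case: df dg => mf _ _ [mg _ _]; have -> := funext klE.
apply: measurable_fun_ifT; first exact: measurable_fun_ltr.
  apply: measurable_fun_ifT; [exact: measurable_fun_ltr| |exact: measurable_cst].
  by apply/measurable_EFinP; apply: measurable_funM => //; exact: measurable_llr.
exact: measurable_cst.
Qed.

(** This is exp (- L) >= 1 - L multiplied by g.  It shows that the divergence is
    nonnegative and that the negative part of its integrand is at most f. *)
Let kl_ge x : (g x - f x)%:E <= kl x.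
Proof.
case: df dg => _ f0 _ [_ g0 _]; rewrite klE.
have [gx|gx] := ltrP 0%R (g x); last first.
  by rewrite lee_fin; have := f0 x; lra.
have [fx|fx] := ltrP 0%R (f x); last exact: leey.
rewrite lee_fin -(expR_llr fx gx).
have := expR_ge1Dx (- llr f g x); nra.
Qed.

Let int_kl_neg : \int[mu]_x kl^\- x <= 1.
Proof.
case: df dg => mf f0 f1 [_ g0 _]; rewrite -f1; apply: ge0_le_integral => //.
- exact: measurable_funeneg.
- exact/measurable_EFinP.
- move=> x _; rewrite funenegE ge_max lee_fin f0 andbT leeNl.
  by apply: le_trans (kl_ge x); rewrite -EFinN lee_fin; have := g0 x; lra.
Qed.

Let integrable_kl : KL mu g f < +oo -> mu.-integrable setT kl.
Proof.
rewrite /KL [X in X < _]integralE => klfin; apply/integrableP; split => //.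
rewrite (eq_integral (fun x => kl^\+ x + kl^\- x)); last first.
  by move=> x _; rewrite -/((abse \o kl) x) fune_abse.
rewrite ge0_integralD//; [|exact: measurable_funepos|exact: measurable_funeneg].
apply: lte_add_pinfty; last exact: le_lt_trans int_kl_neg (ltry _).
rewrite ltNge leye_eq; apply/negP => /eqP kly; move: klfin; rewrite kly.
rewrite addye//; have : - (\int[mu]_x kl^\- x) \is a fin_num.
  rewrite fin_numN ge0_fin_numE ?integral_ge0//.
  exact: le_lt_trans int_kl_neg (ltry _).
by rewrite fin_numE => /andP[].
Qed.

Let integral_g_f : \int[mu]_x (g x - f x)%:E = 0.
Proof.
under eq_integral do rewrite EFinB.
rewrite integralB//; [|exact: density_integrable|exact: density_integrable].
by case: df dg => _ _ -> [_ _ ->]; rewrite subee.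
Qed.

Lemma KL_ge0 : 0 <= KL mu g f.
Proof.
have [klfin|] := ltP (KL mu g f) +oo; last exact: le_trans.
rewrite -integral_g_f; apply: le_integral; last by move=> x _; exact: kl_ge.
- exact: measurableT.
- under eq_fun do rewrite EFinB.
  by apply: integrableB => //; exact: density_integrable.
- exact: integrable_kl.
Qed.

Hypothesis KLfin : KL mu g f < +oo.

(** The integrand of the divergence is infinite where f = 0 < g, so that set is
    null. *)
Let kl_llr : ae_eq mu setT kl (fun x => (llr f g x * g x)%:E).
Proof.
apply: filterS (integrable_ae measurableT (integrable_kl KLfin)) => x /(_ I).
case: dg => _ g0 _; rewrite klE => + _; have [gx|gx] := ltrP 0%R (g x); last first.
  by rewrite (_ : g x = 0%R) ?mulr0//; apply/eqP; rewrite eq_le gx g0.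
by case: ifP.
Qed.

Let mllr_g : measurable_fun setT (fun x => (llr f g x * g x)%:E).
Proof.
case: dg => mg _ _.
by apply/measurable_EFinP; apply: measurable_funM => //; exact: measurable_llr.
Qed.

Lemma integrable_llr : mu.-integrable setT (fun x => (llr f g x)%:E * (g x)%:E).
Proof.
under eq_fun do rewrite -EFinM.
apply/integrableP; split => //.
have /integrableP[_] := integrable_kl KLfin; congr (_ < _).
apply: ge0_ae_eq_integral => //; [exact: measurableT_comp..|].
exact: (ae_eq_abse kl_llr).
Qed.

Lemma KL_llr : \int[mu]_x ((llr f g x)%:E * (g x)%:E) = KL mu g f.
Proof.
under eq_integral do rewrite -EFinM.
by apply/esym/ae_eq_integral.
Qed.

(** Where both densities are positive, exp (- L) g = f.  The points where g = 0 do
    not contribute, whence the restriction on the right, and the set where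
    f = 0 < g is null. *)
Lemma integral_exp_llr B : measurable B ->
  \int[mu]_(x in B) ((expR (- llr f g x))%:E * (g x)%:E) =
  \int[mu]_(x in B `&` [set x | (0 < g x)%R]) (f x)%:E.
Proof.
move=> mB; case: (df) (dg) => mf f0 _ [mg g0 _].
have mpos := measurable_gt0 mg.
rewrite integral_mkcondr; apply: ge0_ae_eq_integral => //.
- apply/measurable_funTS/measurable_EFinP; apply: measurable_funM => //.
  apply: (measurableT_comp (@measurable_expR R)); apply: measurableT_comp => //.
  exact: measurable_llr.
- apply/(measurable_restrict _ mpos mB)/measurable_funTS.
  exact/measurable_EFinP.
- by move=> x _; rewrite mule_ge0// lee_fin ?expR_ge0.
- by move=> x _; rewrite patchE; case: ifP; rewrite lee_fin.
- apply: filterS (integrable_ae measurableT (integrable_kl KLfin)) => x /(_ I).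
  rewrite klE patchE => + _; rewrite -EFinM.
  have [gx|gx] := ltrP 0%R (g x); last first.
    rewrite memNset/=; last by rewrite ltNge gx.
    by rewrite (_ : g x = 0%R) ?mulr0//; apply/eqP; rewrite eq_le gx g0.
  by rewrite mem_set//; have [fx|//] := ltrP 0%R (f x); rewrite expR_llr.
Qed.

End log_likelihood_ratio.

(** * Change of measure on the observations *)

Section weighted_measure.
Context {d} {T : measurableType d} {R : realType}.
Variables (mu : {measure set T -> \bar R}) (u : T -> \bar R).
Hypotheses (mu_u : measurable_fun setT u) (u0 : forall x, (0 <= u x)%E).
Local Open Scope ereal_scope.

(** The proofs are arguments so that the measure structure can be attached to the
    function. *)
Definition weighted_measure of measurable_fun setT u & (forall x, 0 <= u x) :=
  fun A : set T => \int[mu]_(x in A) u x.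
Local Notation m := (weighted_measure mu_u u0).

Let m0 : m set0 = 0. Proof. exact: integral_set0. Qed.

Let m_ge0 A : 0 <= m A. Proof. exact: integral_ge0. Qed.

Let m_sigma_additive : semi_sigma_additive m.
Proof.
move=> F mF tF mUF; rewrite /weighted_measure ge0_integral_bigcup//.
  by apply: is_cvg_ereal_nneg_natsum => n _; exact: integral_ge0.
exact: measurable_funTS.
Qed.

HB.instance Definition _ := isMeasure.Build _ _ _ m m0 m_ge0 m_sigma_additive.

End weighted_measure.

Section change_of_measure.
Context {d} {E : measurableType d} {d'} {Omega : measurableType d'} {R : realType}.
Variables (X : nat -> {mfun Omega >-> E}) (P Q : probability Omega R).
Hypotheses (indP : independent_process X P) (indQ : independent_process X Q).
Local Open Scope ereal_scope.

(** Both sides are finite measures in A.  On a cylinder the left side factorizes by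
    independence under Q, each factor becomes a marginal probability under P, and
    independence under P recombines them.  The sets S k make room for the part of P
    that is singular with respect to Q. *)
Lemma change_of_measure n (w : nat -> E -> R) (S : nat -> set E) A :
  (forall k, measurable_fun setT (w k)) -> (forall k x, 0 <= w k x)%R ->
  (forall k, measurable (S k)) ->
  (forall k B, (1 <= k <= n)%N -> measurable B ->
    \int[Q]_(x in X k @^-1` B) (w k (X k x))%:E = P (X k @^-1` (B `&` S k))) ->
  obs_filtration X n A ->
  \int[Q]_(x in A) (\prod_(1 <= k < n.+1) w k (X k x))%:E = P (A `&` cylinder X n S).
Proof.
move=> mw w0 mS wS FA.
have mW : measurable_fun setT (fun x => (\prod_(1 <= k < n.+1) w k (X k x))%:E).
  apply/measurable_EFinP; apply: (@measurable_fun_past _ _ _ _ X _ _ n).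
  exact: measurable_prod_past.
have W0 x : 0 <= (\prod_(1 <= k < n.+1) w k (X k x))%:E.
  by rewrite lee_fin prodr_ge0.
have mcyl : measurable (cylinder X n S).
  apply: (@obs_filtration_measurable _ _ _ _ X n).
  by apply: (cylinders_obs_filtration (leqnn n)); exists S.
apply/esym; rewrite -[LHS]/(mrestr P mcyl A) -[RHS]/(weighted_measure Q mW W0 A).
apply: (eq_measure_obs_filtration _ _ FA); last first.
  by rewrite /= /mrestr (le_lt_trans (probability_le1 _ _)) ?ltry//; exact: measurableI.
move=> B mB; rewrite /= /mrestr /weighted_measure cylinderI cylinder_iota.
rewrite indP ?iota_uniq//; last 2 first.
- by move=> i; rewrite mem_iota => /andP[].
- by move=> i; exact: measurableI.
transitivity (\int[Q]_x
    (\prod_(1 <= k < n.+1) (w k (X k x) * \1_(B k) (X k x)))%:E).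
  rewrite (integral_prod_obs indQ n (h := fun k x => w k x * \1_(B k) x)%R)//; last 2 first.
  - by move=> k; apply: measurable_funM.
  - by move=> k x; rewrite mulr_ge0.
  rewrite /index_iota subn1/=; apply: eq_big_seq => k; rewrite mem_iota add1n ltnS => kn.
  rewrite -wS// [LHS]integral_mkcond; apply: eq_integral => x _.
  rewrite patchE indicE; have [xB|xB] := boolP (X k x \in B k).
    by rewrite mem_set ?mulr1//; exact: set_mem.
  by rewrite memNset ?mulr0//= => xB'; rewrite mem_set in xB.
rewrite [RHS]integral_mkcond; apply: eq_integral => x _; rewrite patchE.
have [xB|xB] := boolP (x \in cylinder X n B).
  congr EFin; apply: eq_big_nat => k; rewrite ltnS => kn.
  by rewrite indicE mem_set ?mulr1//; exact: (set_mem xB).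
move: xB; rewrite notin_setE => /existsNP[k] /not_implyP[/= kn xB].
rewrite (bigD1_seq k) ?iota_uniq ?mem_index_iota//=.
by rewrite indicE memNset// mulr0 mul0r.
Qed.

(** This is the change of measure with all weights equal to 1. *)
Lemma eq_past_probability n A :
  (forall k B, (1 <= k <= n)%N -> measurable B ->
    Q (X k @^-1` B) = P (X k @^-1` B)) ->
  obs_filtration X n A -> Q A = P A.
Proof.
move=> QP FA.
have mA := obs_filtration_measurable FA.
have := @change_of_measure n (fun _ _ => 1%R) (fun=> setT) A.
rewrite (_ : cylinder _ _ _ = setT) ?setIT; last by apply/seteqP; split.
move=> <- //; first by under eq_integral do rewrite big1//; rewrite integral_cst// mul1e.
move=> k B kn mB; rewrite setIT integral_cst ?mul1e; first exact: QP.
exact: (measurable_obs X k mB).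
Qed.

End change_of_measure.

(** * Information collected up to a stopping time *)

Section stopping_times.
Context {d} {E : measurableType d} {d'} {Omega : measurableType d'} {R : realType}.
Variables (X : nat -> {mfun Omega >-> E}) (tau : Omega -> option nat).
Hypothesis stau : stopping_time R X tau.

Lemma not_beforeS k : not_before R tau k.+1 `<=` not_before R tau k.
Proof.
by move=> w; apply: le_trans; rewrite lee_fin ler_nat.
Qed.

Lemma not_before_obs k : obs_filtration X k (not_before R tau k.+1).
Proof.
rewrite (_ : not_before R tau k.+1 = ~` [set w | (time_val (tau w) <= k%:R%:E :> \bar R)%E]).
  exact: obs_filtrationC.
apply/seteqP; split=> w; rewrite /not_before /=; case: (tau w) => [m|] /=.
- by rewrite !lee_fin !ler_nat => km; apply/negP; rewrite -ltnNge.
- by move=> _; rewrite leye_eq.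
- by rewrite !lee_fin !ler_nat => /negP; rewrite -ltnNge.
- by rewrite leey.
Qed.

Lemma not_before_pred_obs k : (1 <= k)%N ->
  obs_filtration X k.-1 (not_before R tau k).
Proof. by case: k => // k _; exact: not_before_obs. Qed.

Lemma not_before0 : not_before R tau 0 = setT.
Proof.
apply/seteqP; split=> // w _; rewrite /not_before /=.
by case: (tau w) => [n|]; rewrite /= ?leey// lee_fin.
Qed.

Lemma measurable_not_before k : measurable (not_before R tau k).
Proof.
case: k => [|k]; first by rewrite not_before0.
apply: (@obs_filtration_measurable _ _ _ _ X k); exact: not_before_obs.
Qed.

End stopping_times.

Section change_point.
Context {d} {E : measurableType d} {d'} {Omega : measurableType d'} {R : realType}.
Variables (mu : {sigma_finite_measure set E -> \bar R}) (f g : nat -> E -> R).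
Variables (X : nat -> {mfun Omega >-> E}).
Variables (Pinf : probability Omega R) (P : nat -> probability Omega R).
Hypotheses (hf : forall n, (1 <= n)%N -> is_density mu (f n))
           (hg : forall n, (1 <= n)%N -> is_density mu (g n)).
Hypothesis hP : change_point_model mu X f g Pinf P.
Hypothesis KLfin : forall n, (1 <= n)%N -> (KL mu (g n) (f n) < +oo)%E.
Variable nu : nat.
Hypothesis nu1 : (1 <= nu)%N.

Let Q := P nu.

Let indP : independent_process X Pinf. Proof. by case: hP => -[]. Qed.

Let indQ : independent_process X Q.
Proof. by case: hP => _ /(_ nu nu1)[]. Qed.

Let lawP k B : (1 <= k)%N -> measurable B ->
  Pinf (X k @^-1` B) = (\int[mu]_(x in B) (f k x)%:E)%E.
Proof. by case: hP => -[_ +] _ => /[apply]; apply. Qed.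

Let lawQ_before k B : (1 <= k < nu)%N -> measurable B ->
  Q (X k @^-1` B) = (\int[mu]_(x in B) (f k x)%:E)%E.
Proof.
move=> /andP[k1 knu] mB; case: hP => _ /(_ nu nu1)[_ ->]//.
by rewrite knu.
Qed.

Let lawQ_after k B : (nu <= k)%N -> measurable B ->
  Q (X k @^-1` B) = (\int[mu]_(x in B) (g k x)%:E)%E.
Proof.
move=> knu mB; case: hP => _ /(_ nu nu1)[_ ->]//; last exact: leq_trans knu.
by rewrite ltnNge knu.
Qed.

Lemma eq_before_change n A : (n < nu)%N -> obs_filtration X n A -> P nu A = Pinf A.
Proof.
move=> nnu; apply: (eq_past_probability indP indQ) => k B /andP[k1 kn] mB.
by rewrite lawP// lawQ_before// k1 (leq_ltn_trans kn).
Qed.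

Local Open Scope ereal_scope.

Let ge0_integral_obs k B (h : E -> \bar R) : (nu <= k)%N -> measurable B ->
  measurable_fun setT h -> (forall x, 0 <= h x) ->
  \int[Q]_(w in X k @^-1` B) h (X k w) = \int[mu]_(x in B) (h x * (g k x)%:E).
Proof.
move=> knu mB mh h0.
rewrite -[LHS](@ge0_integral_pushforward _ _ _ _ _ (X k) _ Q B h)//; last exact: measurable_funTS.
rewrite integral_mkcond.
rewrite (@ge0_integral_density _ _ _ mu (g k) (hg (leq_trans nu1 knu)) (distribution Q (X k)))//.
- rewrite [RHS]integral_mkcond; apply: eq_integral => x _; rewrite !patchE.
  by case: ifP; rewrite ?mul0e.
- by move=> C mC; exact: lawQ_after.
- by apply/(measurable_restrict _ mB measurableT); rewrite setTI; exact: measurable_funTS.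
- by move=> x; rewrite patchE; case: ifP.
Qed.

Lemma integral_exp_llr_obs k B : (nu <= k)%N -> measurable B ->
  \int[P nu]_(w in X k @^-1` B) (expR (- llr (f k) (g k) (X k w)))%:E =
  Pinf (X k @^-1` (B `&` [set x | (0 < g k x)%R])).
Proof.
move=> knu mB; have k1 := leq_trans nu1 knu.
have mg : measurable_fun setT (g k) by case: (hg k1).
have mpos := measurable_gt0 mg.
rewrite (@ge0_integral_obs k B (fun x => (expR (- llr (f k) (g k) x))%:E))//.
- rewrite (integral_exp_llr (hf k1) (hg k1))//; last exact: KLfin.
  by rewrite lawP//; exact: measurableI.
- apply/measurable_EFinP/(measurableT_comp (@measurable_expR R)).
  by apply: measurableT_comp => //; exact: (measurable_llr (hf k1) (hg k1)).
Qed.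

Let mllr k : (nu <= k)%N -> measurable_fun setT (llr (f k) (g k)).
Proof.
move=> knu; have k1 := leq_trans nu1 knu.
exact: (measurable_llr (hf k1) (hg k1)).
Qed.

Lemma integrable_llr_obs k : (nu <= k)%N ->
  (P nu).-integrable setT (fun w => (llr (f k) (g k) (X k w))%:E).
Proof.
move=> knu; have k1 := leq_trans nu1 knu.
have lawk B (mB : measurable B) := lawQ_after knu mB.
have mk : measurable_fun setT (EFin \o llr (f k) (g k)).
  by apply/measurable_EFinP; exact: mllr.
have /integrableP[_ +] := integrable_density (hg k1) (nu := distribution Q (X k))
  lawk mk (integrable_llr (hf k1) (hg k1) (KLfin k1)).
rewrite (ge0_integral_distribution (P := Q) (X k))//; last exact: measurableT_comp.
by move=> kfin; apply/integrableP; split => //; exact: (measurableT_comp mk).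
Qed.

Lemma expectation_llr_obs k : (nu <= k)%N ->
  \int[P nu]_w (llr (f k) (g k) (X k w))%:E = KL mu (g k) (f k).
Proof.
move=> knu; have k1 := leq_trans nu1 knu.
have lawk B (mB : measurable B) := lawQ_after knu mB.
have mk : measurable_fun setT (EFin \o llr (f k) (g k)).
  by apply/measurable_EFinP; exact: mllr.
rewrite -(KL_llr (hf k1) (hg k1) (KLfin k1)).
rewrite -(integral_density (hg k1) (nu := distribution Q (X k)) lawk mk).
by rewrite (integral_distribution (P := Q) (X := X k))//; exact: integrable_llr_obs.
Qed.

Definition cum_llr n (w : Omega) : R :=
  (\sum_(nu <= k < n) llr (f k) (g k) (X k w))%R.

(** The weights are 1 before nu and exp (- L_k) from nu on.  Equality may fail, as
    Pinf can charge the sets where some g_k vanishes. *)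
Lemma integral_exp_cum_llr_le n A : (nu <= n.+1)%N -> obs_filtration X n A ->
  \int[P nu]_(w in A) (expR (- cum_llr n.+1 w))%:E <= Pinf A.
Proof.
move=> nun FA.
pose w k : E -> R := if (nu <= k)%N then (fun x => expR (- llr (f k) (g k) x)) else cst 1%R.
pose S k : set E := if (nu <= k)%N then [set x | (0 < g k x)%R] else setT.
have mS k : measurable (S k).
  rewrite /S; case: ifPn => // knu; apply: measurable_gt0.
  by case: (hg (leq_trans nu1 knu)).
have mA := obs_filtration_measurable FA.
have Fcyl : obs_filtration X n (cylinder X n S).
  by apply: (cylinders_obs_filtration (leqnn n)); exists S.
have mcyl := obs_filtration_measurable Fcyl.
rewrite (_ : \int[_]_(w in A) _ = Pinf (A `&` cylinder X n S)).
  by apply: le_measure; rewrite ?inE//; exact: measurableI.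
rewrite -(change_of_measure indP indQ (w := w))//.
- apply: eq_integral => x _; congr EFin.
  rewrite /cum_llr -sumrN expR_sum (big_cat_nat nu1 nun)/=.
  rewrite [X in (X * _)%R]big1_seq ?mul1r; last first.
    move=> k; rewrite mem_index_iota /w => /andP[_ /andP[_]].
    by rewrite ltnNge => /negbTE ->.
  by apply: eq_big_nat => k /andP[nuk _]; rewrite /w nuk.
- move=> k; rewrite /w; case: ifPn => // nuk.
  apply: (measurableT_comp (@measurable_expR R)).
  by apply: measurableT_comp => //; exact: mllr.
- by move=> k x; rewrite /w; case: ifPn => // _; exact: expR_ge0.
- move=> k B /andP[k1 kn] mB; rewrite /w /S; case: ifPn => [nuk|].
    exact: integral_exp_llr_obs.
  rewrite -ltnNge => knu; rewrite setIT /= integral_cst ?mul1e.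
    by rewrite lawP// -(@lawQ_before k B _ mB) ?k1.
  exact: (measurable_obs X k mB).
Qed.

Lemma integrable_cum_llr n : (P nu).-integrable setT (EFin \o cum_llr n).
Proof.
rewrite (_ : _ \o _ = fun w =>
    \sum_(k <- index_iota nu n | (nu <= k < n)%N) (llr (f k) (g k) (X k w))%:E).
  by apply: integrable_sum => // k /andP[nuk _]; exact: integrable_llr_obs.
apply/funext => w; rewrite /= /cum_llr [in LHS]big_nat_cond -sumEFin.
by apply: eq_bigl => k; rewrite andbT.
Qed.

(** The event A belongs to the past of X_k and is independent of it: this is the
    step behind Wald's identity. *)
Lemma integral_past_llr n k A : (n < k)%N -> (nu <= k)%N -> obs_filtration X n A ->
  \int[P nu]_(w in A) (llr (f k) (g k) (X k w))%:E = P nu A * KL mu (g k) (f k).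
Proof.
move=> nk nuk FA; have k1 := leq_trans nu1 nuk.
have mA := obs_filtration_measurable FA.
have lint := integrable_llr_obs nuk.
have ge0 (h : E -> \bar R) : measurable_fun setT h -> (forall x, 0 <= h x) ->
    \int[P nu]_(w in A) h (X k w) = P nu A * \int[P nu]_w h (X k w).
  move=> mh h0.
  have -> : P nu A = \int[P nu]_w (\1_A w)%:E by rewrite integral_indic// setIT.
  rewrite [LHS]integral_mkcond.
  rewrite -(ge0_integralM_past indQ (u := fun w => (\1_A w)%:E) nk)//; last first.
    apply/measurable_EFinP; exact: (@measurable_realfun.measurable_indic _ (past X n) R setT A FA).
  apply: eq_integral => w _; rewrite patchE indicE.
  by case: ifP => _; rewrite ?mul1e ?mul0e.
pose h := EFin \o llr (f k) (g k).
have mh : measurable_fun setT h by apply/measurable_EFinP; exact: mllr.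
have posE D : \int[P nu]_(w in D) (h \o X k)^\+ w = \int[P nu]_(w in D) h^\+ (X k w).
  by rewrite funepos_comp.
have negE D : \int[P nu]_(w in D) (h \o X k)^\- w = \int[P nu]_(w in D) h^\- (X k w).
  by rewrite funeneg_comp.
rewrite -expectation_llr_obs// -[LHS]/(\int[P nu]_(w in A) (h \o X k) w).
rewrite -[X in _ = _ * X]/(\int[P nu]_w (h \o X k) w) integralE [in RHS]integralE.
rewrite !posE !negE (ge0 h^\+) ?(ge0 h^\-)//; last 2 first.
- exact: measurable_funeneg.
- exact: measurable_funepos.
rewrite [RHS]muleBr//; first exact: fin_num_measure.
rewrite -posE -negE fin_num_adde_defl// fin_numN.
exact: integrable_neg_fin_num.
Qed.

Local Open Scope ring_scope.

(** Integrate L >= 1 + c - exp (c - L) over A.  The best choice of c would give the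
    log-sum inequality; a free c avoids logarithms of probabilities. *)
Lemma integral_cum_llr_ge n A c : (nu <= n.+1)%N -> obs_filtration X n A ->
  (1 + c) * fine (P nu A) - expR c * fine (Pinf A) <=
  \int[P nu]_(w in A) cum_llr n.+1 w.
Proof.
move=> nun FA; have mA := obs_filtration_measurable FA.
have eint : (P nu).-integrable A (EFin \o (fun w => expR (- cum_llr n.+1 w))).
  apply/integrableP; split.
    apply/measurable_EFinP/measurable_funTS.
    apply: (measurableT_comp (@measurable_expR R)); apply: measurableT_comp => //.
    apply/measurable_EFinP.
    by case/integrableP : (integrable_cum_llr n.+1).
  under eq_integral do rewrite /= ger0_norm ?expR_ge0//.
  exact: le_lt_trans (integral_exp_cum_llr_le nun FA) (le_lt_trans (probability_le1 _ mA) (ltry _)).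
have lint : (P nu).-integrable A (EFin \o cum_llr n.+1).
  exact: integrableS (integrable_cum_llr _).
have cint r : (P nu).-integrable A (EFin \o cst r) by exact: finite_measure_integrable_cst.
have ceint : (P nu).-integrable A
    (EFin \o (fun w => expR c * expR (- cum_llr n.+1 w))).
  by have := integrableZl mA (expR c) eint; apply: eq_integrable.
apply: (@le_trans _ _ (\int[P nu]_(w in A) ((1 + c) - expR c * expR (- cum_llr n.+1 w)))).
  have cstE : \int[P nu]_(w in A) (1 + c) = (1 + c) * fine (P nu A).
    exact: Rintegral_cst.
  rewrite RintegralB//; last exact: (cint (1 + c)).
  rewrite cstE RintegralZl// lerB// ler_pM2l ?expR_gt0//.
  apply: fine_le; [exact: integrable_fin_num|exact: fin_num_measure|].
  exact: integral_exp_cum_llr_le.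
apply: le_Rintegral => //.
  by have := integrableB mA (cint (1 + c)) ceint; apply: eq_integrable.
move=> w _; rewrite -expRD.
have := expR_ge1Dx (c + - cum_llr n.+1 w); lra.
Qed.

Variable tau : Omega -> option nat.
Hypothesis stau : stopping_time R X tau.
Local Notation t := (not_before R tau).
Let q k := fine (P nu (t k)).
Let p k := fine (Pinf (t k)).

Let t_obs k : (nu <= k)%N -> obs_filtration X k.-1 (t k).
Proof. by move=> nuk; apply: (not_before_pred_obs stau); exact: leq_trans nuk. Qed.

Let mt k : measurable (t k). Proof. exact: (measurable_not_before stau). Qed.

(** Induction on the length of the window.  Extending it by the time n = nu + m adds
    the mean of L_n over {tau >= n} on the right.  On the left, the log-likelihood
    ratio is then final on {tau = n}, where it is bounded from below at once, and it
    remains under the integral on {tau >= n + 1}. *)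
Lemma stopped_llr_ge m c :
  (1 + c) * (q nu - q (nu + m)) - expR c * (p nu - p (nu + m))
    + \int[P nu]_(w in t (nu + m)) cum_llr (nu + m) w <=
  \sum_(nu <= k < nu + m) fine (KL mu (g k) (f k)) * q k.
Proof.
elim: m => [|m IHm].
  rewrite addn0 !subrr !mulr0 subr0 add0r big_geq//.
  rewrite (@eq_Rintegral _ _ _ (P nu) _ (fun=> 0)); last first.
    by move=> w _; rewrite /cum_llr big_geq.
  by rewrite [X in X <= _](_ : _ = 0) // (Rintegral_cst (P nu) (mt nu)) mul0r.
rewrite addnS big_nat_recr ?leq_addr//=; set n := (nu + m)%N in IHm *.
have nun : (nu <= n)%N by rewrite leq_addr.
have n1 := leq_trans nu1 nun.
have mtn := mt n; have mtn1 := mt n.+1.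
have tn : obs_filtration X n (t n).
  by apply: sub_obs_filtration (t_obs nun); exact: leq_pred.
have tn1 : obs_filtration X n (t n.+1) by exact: not_before_obs.
set A := t n `\` t n.+1.
have FA : obs_filtration X n A.
  by rewrite /A setDE; apply: obs_filtrationI => //; exact: obs_filtrationC.
have mA := obs_filtration_measurable FA.
have AE (mm : probability Omega R) : fine (mm A) = fine (mm (t n)) - fine (mm (t n.+1)).
  rewrite /A measureD//; last by rewrite -ge0_fin_numE// fin_num_measure.
  rewrite setIidr ?fineB ?fin_num_measure//.
  exact: not_beforeS.
have llrD : \int[P nu]_(w in t n) cum_llr n.+1 w =
    \int[P nu]_(w in t n) cum_llr n w + fine (KL mu (g n) (f n)) * q n.
  rewrite mulrC -fineM; last 2 first.
  - exact: fin_num_measure.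
  - by rewrite ge0_fin_numE ?KLfin// KL_ge0//; [exact: hf|exact: hg].
  rewrite -(@integral_past_llr n.-1 n)//; last 2 first.
  - by rewrite prednK.
  - exact: t_obs.
  rewrite -[fine _]/(\int[P nu]_(w in t n) llr (f n) (g n) (X n w)) -RintegralD//.
  - by apply: eq_Rintegral => w _; rewrite /cum_llr big_nat_recr.
  - exact: integrableS (integrable_cum_llr _).
  - exact: integrableS (integrable_llr_obs nun).
have llrU : \int[P nu]_(w in t n) cum_llr n.+1 w =
    \int[P nu]_(w in t n.+1) cum_llr n.+1 w + \int[P nu]_(w in A) cum_llr n.+1 w.
  rewrite -Rintegral_setU//.
  - by congr Rintegral; rewrite /A setDUK//; exact: not_beforeS.
  - by apply: integrableS (integrable_cum_llr _) => //; exact: measurableU.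
  - by apply/disj_setPS; rewrite /A setDE setICA setICr setI0.
have := integral_cum_llr_ge c (leqW nun) FA.
rewrite !AE -/(q n) -/(q n.+1) -/(p n) -/(p n.+1) => llrA.
move: IHm llrD llrU llrA; lra.
Qed.

(** The integral left over from [stopped_llr_ge], on the event that tau exceeds the
    window, is bounded from below with c = 0. *)
Lemma stopped_information_ge m c :
  (1 + c) * (q nu - q (nu + m)) - expR c * (p nu - p (nu + m))
    + q (nu + m) - p (nu + m) <=
  \sum_(nu <= k < nu + m) fine (KL mu (g k) (f k)) * q k.
Proof.
have num : (nu <= nu + m)%N by rewrite leq_addr.
have := stopped_llr_ge m c.
have := @integral_cum_llr_ge (nu + m).-1 (t (nu + m)) 0.
rewrite prednK ?(leq_trans nu1 num)// expR0 addr0 !mul1r.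
move=> /(_ num (t_obs num)); rewrite -/(q _) -/(p _); lra.
Qed.

End change_point.

(** * Sums of monotone and of periodic sequences *)

Section monotone_sequences.
Context {R : realType}.

Lemma sum_nonincreasing_ge (q : nat -> R) (nu i j k : nat) :
  nonincreasing_seq q -> (nu + j <= k.+1)%N ->
  (j - i)%:R * q k <= \sum_(i <= l < j) q (nu + l)%N.
Proof.
move=> qmono jk; rewrite mulr_natl -sumr_const_nat.
rewrite big_nat_cond [leRHS]big_nat_cond; apply: ler_sum => l /andP[/andP[_ lj] _].
by apply: qmono; rewrite -ltnS (leq_trans _ jk)// ltn_add2l.
Qed.

(** Otherwise every window of length M takes away more than the proportion 2 M / b
    of the tail.  Summed over the starting points of the windows these losses
    telescope to at most M, so the sum of the tail is at most b / 2. *)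
Lemma exists_slow_decay (p : nat -> R) (b : R) (M N : nat) :
  (0 < M)%N -> 0 < b ->
  (forall k, 0 <= p k <= 1) -> nonincreasing_seq p ->
  b / 2 < \sum_(1 <= k < N.+1) p k ->
  exists nu, [/\ (1 <= nu)%N, 0 < p nu & b * (p nu - p (nu + M)%N) <= 2 * M%:R * p nu].
Proof.
move=> M0 b0 p01 pmono bN; apply: contrapT => H.
have pge k : 0 <= p k by case/andP: (p01 k).
have pD k j : p (k + j)%N <= p k by apply: pmono; exact: leq_addr.
have fast k : (1 <= k)%N -> 2 * M%:R * p k <= b * (p k - p (k + M)%N).
  move=> k1; have [pk|] := ltrP 0 (p k).
    rewrite leNgt; apply/negP => Hk; apply: H; exists k; split=> //; exact: ltW.
  move=> pk; have pk0 : p k = 0 by apply/le_anti; rewrite pk pge.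
  have : p (k + M)%N = 0 by apply/le_anti; rewrite pge andbT -pk0 pD.
  by rewrite pk0 => ->; rewrite subrr !mulr0.
have sumfast : 2 * M%:R * (\sum_(1 <= k < N.+1) p k) <=
    b * (\sum_(1 <= k < N.+1) p k - \sum_(1 <= k < N.+1) p (k + M)%N).
  rewrite -sumrB !mulr_sumr big_nat_cond [leRHS]big_nat_cond.
  by apply: ler_sum => k /andP[/andP[k1 _] _]; exact: fast.
have sumM : \sum_(1 <= k < N.+1) p k - \sum_(1 <= k < N.+1) p (k + M)%N <= M%:R.
  rewrite lerBlDr.
  have -> : \sum_(1 <= k < N.+1) p (k + M)%N = \sum_(M.+1 <= k < (N + M).+1) p k.
    by rewrite -[M.+1]add1n -[(N + M).+1]addSn big_addn addnK.
  apply: (@le_trans _ _ (\sum_(1 <= k < (N + M).+1) p k)).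
    rewrite (@big_cat_nat _ _ _ N.+1 1 (N + M).+1)//= ?ltnS ?leq_addr//.
    by rewrite lerDl sumr_ge0.
  rewrite (@big_cat_nat _ _ _ M.+1 1 (N + M).+1)//= ?ltnS ?leq_addl//.
  rewrite lerD2r -[M in M%:R](subn0 M) -subSS.
  rewrite -[leRHS]mulr_natl mulr1 -sumr_const_nat.
  by apply: ler_sum => k _; case/andP: (p01 k).
have M0' : 0 < M%:R :> R by rewrite ltr0n.
move: (\sum_(1 <= k < N.+1) p k) bN sumfast sumM => S bN.
move=> sumfast sumM; have := le_trans sumfast (ler_wpM2l (ltW b0) sumM).
by rewrite -mulrA mulrCA (mulrC b) ler_pM2l//; lra.
Qed.

Lemma sum_periodic (D : nat -> R) (T nu : nat) :
  (forall n, (1 <= n)%N -> D (n + T)%N = D n) -> (1 <= nu)%N ->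
  \sum_(nu <= k < nu + T) D k = \sum_(1 <= k < T.+1) D k.
Proof.
move=> DT; case: nu => // nu _; elim: nu => [|nu IH]; first by rewrite add1n.
rewrite -{}IH; have [->|T0] := posnP T; first by rewrite !addn0 !big_geq.
rewrite [RHS]big_ltn; last by rewrite -addn1 leq_add2l.
rewrite (addSn nu.+1) big_nat_recr; last by rewrite -addn1 leq_add2l.
by rewrite [(_ + _)%R]addrC /= DT.
Qed.

(** On each period the q_k are at most the value at its start, which is at most their
    average over the preceding period.  The first period has no predecessor and
    accounts for the term T I q_nu. *)
Lemma periodic_sum_le (D q : nat -> R) (T m nu : nat) (I : R) :
  (forall n, (1 <= n)%N -> D (n + T)%N = D n) ->
  (forall n, (1 <= n)%N -> 0 <= D n) ->
  \sum_(1 <= k < T.+1) D k = T%:R * I -> 0 <= I ->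
  (forall k, 0 <= q k) -> nonincreasing_seq q -> (1 <= nu)%N ->
  \sum_(nu <= k < nu + T * m) D k * q k <=
  T%:R * I * q nu + I * \sum_(1 <= i < (T * m).+1) q (nu + i)%N.
Proof.
move=> DT D0 DI I0 q0 qmono nu1.
(* The added term is the bound on the next period, for the induction. *)
suff : \sum_(nu <= k < nu + T * m) D k * q k + T%:R * I * q (nu + T * m)%N <=
    T%:R * I * q nu + I * \sum_(1 <= i < (T * m).+1) q (nu + i)%N.
  by apply: le_trans; rewrite lerDl !mulr_ge0.
elim: m => [|m IHm]; first by rewrite muln0 addn0 !big_geq// mulr0 addrC.
rewrite mulnS (addnC T) addnA; set n := (nu + T * m)%N in IHm *.
have n1 : (1 <= n)%N by rewrite (leq_trans nu1)// leq_addr.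
rewrite (@big_cat_nat _ _ _ n nu (n + T))//= ?leq_addr//.
rewrite (@big_cat_nat _ _ _ (T * m).+1 1 (T * m + T).+1)//= ?ltnS ?leq_addr//.
have block : \sum_(n <= k < n + T) D k * q k <= T%:R * I * q n.
  rewrite -DI -(sum_periodic DT n1) mulr_suml.
  rewrite big_nat_cond [leRHS]big_nat_cond; apply: ler_sum => k /andP[/andP[nk _] _].
  apply: ler_wpM2l; first exact/D0/(leq_trans n1).
  exact: qmono.
have tail : T%:R * q (n + T)%N <= \sum_((T * m).+1 <= i < (T * m + T).+1) q (nu + i)%N.
  have := @sum_nonincreasing_ge q nu (T * m).+1 (T * m + T).+1 (n + T) qmono.
  by rewrite subSS addKn; apply; rewrite addnS /n addnA.
move: IHm block (ler_wpM2l I0 tail); rewrite mulrDr mulrA (mulrC I T%:R).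
set a := \sum_(_ <= _ < _) _ * _; set b := \sum_(_ <= _ < _) _ * _.
set x := I * _; set y := I * _; set z := T%:R * I * _; set u := T%:R * I * _; lra.
Qed.

End monotone_sequences.

(** * The error term *)

Section asymptotics.
Context {R : realType}.

(** With y = sqrt (log b), the quotient of (y^2 - 4 y - K) / (I + 1 / y), which
    bounds the delay from below, by log b / I = y^2 / I is 1 plus this error.  The
    value - 1 for small b makes the bound trivial there. *)
Definition rate_error (I K b : R) : R :=
  let y := Num.sqrt (ln b) in
  if y < 4 then - 1 else
  (1 - 4 * y^-1 - K * (y^-1 * y^-1)) * (I * (I + y^-1)^-1) - 1.

Lemma sqrt_ln_cvgy : Num.sqrt (ln b) @[b --> +oo] --> (+oo : set_system R).
Proof.
apply/cvgryPge => A; near=> b.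
have lnb : A ^+ 2 <= ln b.
  have b0 : 0 < b by near: b; exact: nbhs_pinfty_gt.
  rewrite -[A ^+ 2]expRK ler_ln ?posrE ?expR_gt0//.
rewrite (le_trans (ler_norm A))// -sqrtr_sqr ler_sqrt//.
exact: le_trans (sqr_ge0 A) lnb.
Unshelve. all: by end_near. Qed.

Lemma rate_error_cvg0 (I K : R) : 0 < I -> rate_error I K b @[b --> +oo] --> (0 : R).
Proof.
move=> I0.
have u0 : (Num.sqrt (ln b))^-1 @[b --> +oo] --> (0 : R).
  apply/gtr0_cvgV0; last exact: sqrt_ln_cvgy.
  by move/cvgryPgt : sqrt_ln_cvgy; exact.
pose F (u : R) := (1 - 4 * u - K * (u * u)) * (I * (I + u)^-1) - 1.
have F0 : F u @[u --> (0 : R)] --> F 0.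
  apply: cvgB; last exact: cvg_cst.
  apply: cvgM.
    apply: cvgB; first (apply: cvgB; [exact: cvg_cst|]).
      by apply: cvgM; [exact: cvg_cst|exact: cvg_id].
    by apply: cvgM; [exact: cvg_cst|apply: cvgM; exact: cvg_id].
  apply: cvgM; first exact: cvg_cst.
  apply: cvgV; first by rewrite addr0 gt_eqF.
  by apply: cvgD; [exact: cvg_cst|exact: cvg_id].
have FE : F 0 = 0.
  by rewrite /F !mulr0 !subr0 addr0 mul1r divff ?gt_eqF// subrr.
rewrite FE in F0.
apply: cvg_trans (cvg_comp _ _ u0 F0).
apply: near_eq_cvg; near=> b; rewrite /rate_error /= ifF//.
apply/negbTE; rewrite -leNgt; near: b.
by move/cvgryPge : sqrt_ln_cvgy; exact.
Unshelve. all: by end_near. Qed.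

Lemma rate_errorE (I K b : R) : 0 < I -> 4 <= Num.sqrt (ln b) ->
  let y := Num.sqrt (ln b) in
  ln b / I * (1 + rate_error I K b) = (y ^+ 2 - 4 * y - K) / (I + y^-1).
Proof.
move=> I0 y4 y; rewrite /rate_error ltNge y4 /= -/y.
have y0 : 0 < y by apply: lt_le_trans y4.
have -> : ln b = y ^+ 2.
  rewrite /y sqr_sqrtr// leNgt; apply/negP => /ltW /ler0_sqrtr lb.
  by move: y4; rewrite lb; lra.
have Iy : 0 < I * y + 1 by rewrite addr_gt0// mulr_gt0.
by field; rewrite !gt_eqF.
Qed.

(** In the application, a is the common value of q_nu and p_nu, q and p are the tails
    at the end of a window of length T m, and s is the sum of the tails under P nu
    over the window.  As 2 (y^3 + 1) <= exp (4 y), the choice of c makes the term with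
    exp c at most T a; as the window has length at least y^3, c q is at most s / y. *)
Lemma delay_arith (I y a s q p c : R) (T m : nat) : 0 < I -> (1 <= T)%N -> 4 <= y ->
  y ^+ 3 <= m%:R -> m%:R <= y ^+ 3 + 1 -> 0 < a -> 0 <= q -> 0 <= p <= a -> 0 <= s ->
  (T * m)%:R * q <= s -> c = y ^+ 2 - 4 * y ->
  expR (y ^+ 2) * (a - p) <= 2 * (T * m)%:R * a ->
  (1 + c) * (a - q) - expR c * (a - p) + q - p <= T%:R * I * a + I * s ->
  (y ^+ 2 - 4 * y - T%:R * (1 + I)) * a <= s * (I + y^-1).
Proof.
move=> I0 T1 y4 my ym a0 q0 /andP[p0 pa] s0 qs cE slow info.
have T1' : 1 <= T%:R :> R by rewrite ler1n.
have y0 : 0 < y by lra.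
have e4y : 2 * (y ^+ 3 + 1) <= expR (4 * y).
  have -> : expR (4 * y) = expR y ^+ 4 by rewrite expRM_natl.
  have : (1 + y) ^+ 4 <= expR y ^+ 4.
    by apply: lerXn2r; rewrite ?nnegrE ?expR_ge0 ?expR_ge1Dx//; lra.
  apply: le_trans.
  have -> : (1 + y) ^+ 4 = 1 + 4 * y + 6 * y ^+ 2 + 4 * y ^+ 3 + y ^+ 4 by ring.
  have := exprn_ge0 2 (ltW y0); have := exprn_ge0 3 (ltW y0).
  have := exprn_ge0 4 (ltW y0); lra.
have slow' : expR c * (a - p) <= T%:R * a.
  have e0 : 0 < expR (4 * y) by exact: expR_gt0.
  rewrite -(ler_pM2l e0) mulrA -expRD [X in expR X](_ : _ = y ^+ 2); last by rewrite cE; ring.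
  apply: le_trans slow _; rewrite natrM.
  have : 2 * m%:R <= expR (4 * y) by apply: le_trans e4y; rewrite ler_pM2l.
  move: (expR (4 * y)) => e me.
  have Ta0 : 0 <= T%:R * a by rewrite mulr_ge0 ?ltW//; lra.
  have := ler_wpM2r Ta0 me; nra.
have cq : c * q <= s * y^-1.
  rewrite ler_pdivlMr//.
  have mq : y ^+ 3 * q <= s.
    apply: le_trans qs; rewrite natrM ler_wpM2r//.
    by apply: le_trans my _; rewrite ler_peMl.
  apply: le_trans mq; rewrite cE.
  have : 0 <= y * y * q by rewrite !mulr_ge0// ltW.
  nra.
rewrite mulrDr; nra.
Qed.

End asymptotics.

(** * Integrals compared with constants *)

Section integrals_minus_constant.
Context {d} {T : measurableType d} {R : realType} (Q : {finite_measure set T -> \bar R}).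
Local Open Scope ereal_scope.

(** If the integral of h is infinite, so is that of the positive part of h - c, while
    the negative part is at most c. *)
Lemma ge0_integralB_cst (D : set T) (h : T -> \bar R) (c : R) : measurable D ->
  measurable_fun D h -> (forall x, D x -> 0 <= h x) -> (0 <= c)%R ->
  \int[Q]_(x in D) (h x - c%:E) = \int[Q]_(x in D) h x - c%:E * Q D.
Proof.
move=> mD mh h0 c0.
have cint : Q.-integrable D (EFin \o cst c) by exact: finite_measure_integrable_cst.
have cE : \int[Q]_(x in D) (EFin \o cst c) x = c%:E * Q D by rewrite -integral_cst.
have cfin : c%:E * Q D \is a fin_num by rewrite -cE; exact: integrable_fin_num.
have [hfin|] := ltP (\int[Q]_(x in D) h x) +oo.
  rewrite integralB//= ?cE//; apply/integrableP; split => //.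
  by rewrite (eq_integral h)// => x /set_mem Dx; rewrite gee0_abs// h0.
rewrite leye_eq => /eqP hoo; rewrite hoo addye; last first.
  by rewrite -fin_numN in cfin; move: cfin; rewrite fin_numE => /andP[].
pose k x := h x - c%:E.
have mk : measurable_fun D k by apply: emeasurable_funB => //; exact: measurable_cst.
have neg : \int[Q]_(x in D) k^\- x <= c%:E * Q D.
  rewrite -cE; apply: ge0_le_integral => //; [exact: measurable_funeneg|exact/measurable_EFinP|].
  move=> x Dx; rewrite funenegE ge_max lee_fin c0 andbT /k.
  by rewrite oppeB ?fin_num_adde_defl// geeDr// leeNl oppe0 h0.
have pos : \int[Q]_(x in D) k^\+ x = +oo.
  apply/eqP; rewrite -leye_eq leNgt; apply/negP => posfin.
  suff : \int[Q]_(x in D) h x < +oo by rewrite hoo.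
  apply: le_lt_trans (_ : \int[Q]_(x in D) (k^\+ x + c%:E) < +oo).
    apply: ge0_le_integral => //.
      apply: emeasurable_funD; [exact: measurable_funepos|exact: measurable_cst].
    move=> x Dx; rewrite -leeBlDr// funeposE le_max; apply/orP; left; exact: lexx.
  rewrite ge0_integralD//; [|exact: measurable_funepos].
  by apply: lte_add_pinfty => //; rewrite integral_cst// -ge0_fin_numE// mule_ge0.
rewrite integralE pos addye//.
have : (- (\int[Q]_(x in D) k^\- x)) \is a fin_num.
  rewrite fin_numN ge0_fin_numE ?integral_ge0//; apply: le_lt_trans neg _.
  by rewrite -ge0_fin_numE// mule_ge0.
by rewrite fin_numE => /andP[].
Qed.

(** The upper bound controls the positive part of h, and the sign of the integral then
    controls the negative part: h is integrable over D. *)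
Lemma ae_le_integral_cst (D : set T) (h : T -> \bar R) (r : R) : measurable D ->
  measurable_fun setT h -> {ae Q, forall x, h x <= r%:E} ->
  0 <= \int[Q]_(x in D) h x -> \int[Q]_(x in D) h x <= r%:E * Q D.
Proof.
move=> mD mh hr.
(* Unlike h, its truncation is at most r everywhere. *)
pose k x := mine (h x) r%:E.
have mk : measurable_fun setT k.
  by apply: measurable_mine => //; exact: measurable_cst.
have -> : \int[Q]_(x in D) h x = \int[Q]_(x in D) k x.
  apply: ae_eq_integral => //; [exact: measurable_funTS..|].
  by apply: filterS hr => x hx _; rewrite /k min_l.
have pos : \int[Q]_(x in D) k^\+ x < +oo.
  apply: (@le_lt_trans _ _ (\int[Q]_(x in D) (cst (Num.max r 0)%:E) x)).
    apply: ge0_le_integral => //.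
    - exact/measurable_funepos/measurable_funTS.
    - by move=> x _; rewrite funeposE /= EFin_max ge_max !le_max /k ge_min !lexx ?orbT.
  by rewrite integral_cst// ltey_eq fin_numM// fin_num_measure.
move=> int0.
have neg : \int[Q]_(x in D) k^\- x < +oo.
  rewrite ltNge leye_eq; apply/negP => /eqP negoo; move: int0.
  by rewrite integralE negoo addeNy.
have kint : Q.-integrable D k.
  apply/integrableP; split; first exact: measurable_funTS.
  under eq_integral do rewrite -/((abse \o k) _) fune_abse.
  rewrite ge0_integralD//; last 2 first.
  - exact/measurable_funepos/measurable_funTS.
  - exact/measurable_funeneg/measurable_funTS.
  exact: lte_add_pinfty.
rewrite -integral_cst//; apply: le_integral => //.
  exact: (finite_measure_integrable_cst Q r mD).
by move=> x _; rewrite ge_min lexx orbT.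
Qed.

End integrals_minus_constant.

(** * Expectations of a stopping time *)

Section stopping_time_expectations.
Context {d} {E : measurableType d} {d'} {Omega : measurableType d'} {R : realType}.
Variables (X : nat -> {mfun Omega >-> E}) (tau : Omega -> option nat).
Hypothesis stau : stopping_time R X tau.
Local Notation t := (not_before R tau).
Local Open Scope ereal_scope.

Let mt k : measurable (t k).
Proof. exact: (measurable_not_before stau). Qed.

Lemma sum_indic_not_before nu m w :
  \sum_(0 <= i < m) (\1_(t (nu + i).+1) w)%:E =
  (if tau w is Some n then minn m (n - nu) else m)%:R%:E :> \bar R.
Proof.
elim: m => [|m IHm]; first by rewrite big_geq//; case: (tau w) => //= n; rewrite min0n.
rewrite big_nat_recr//= IHm indicE -EFinD; congr EFin.
case tauw: (tau w) => [n|].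
  have [le|lt] := leqP (nu + m).+1 n.
    rewrite mem_set; last by rewrite /not_before /= tauw /= lee_fin ler_nat.
    by rewrite -natrD; congr (_%:R)%R => /=; lia.
  rewrite memNset; last by rewrite /not_before /= tauw /= lee_fin ler_nat leqNgt ltnS -ltnS lt.
  by rewrite addr0; congr (_%:R)%R; lia.
rewrite mem_set; last by rewrite /not_before /= tauw /= leey.
by rewrite natr1.
Qed.

(** The mean of tau and its conditional expectations are computed from this
    decomposition into the events {tau >= k + 1}. *)
Lemma time_val_sum w :
  time_val (tau w) = \sum_(0 <= k <oo) (\1_(t k.+1) w)%:E :> \bar R.
Proof.
apply/esym/cvg_lim => //.
rewrite (_ : (fun n => _) = fun m =>
    (if tau w is Some n then minn m n else m)%:R%:E); last first.
  apply/funext => m; rewrite -[RHS](_ : \sum_(0 <= i < m) (\1_(t (0 + i).+1) w)%:E = _)//.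
  by rewrite sum_indic_not_before; case: (tau w) => [n|] //; rewrite subn0.
case: (tau w) => [n|] /=.
  apply: cvg_near_cst; near=> m; congr (_%:R%:E); apply/minn_idPr.
  near: m; exact: nbhs_infty_ge.
by apply/cvgeryP; exact: cvgr_idn.
Unshelve. all: by end_near. Qed.

Lemma measurable_time_val : measurable_fun setT (fun w => time_val (tau w) : \bar R).
Proof.
rewrite (_ : (fun _ => _) = fun w => \sum_(0 <= k <oo) (\1_(t k.+1) w)%:E); last first.
  by apply/funext => w; exact: time_val_sum.
apply: ge0_emeasurable_sum => k; first by move=> x _ _; rewrite lee_fin.
by move=> _; apply/measurable_EFinP; exact: measurable_realfun.measurable_indic.
Qed.

Lemma time_val_ge0 w : 0 <= time_val (tau w) :> \bar R.
Proof. by case: (tau w) => [n|] //=; rewrite lee_fin. Qed.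

Lemma expectation_time_val (m : {measure set Omega -> \bar R}) A : measurable A ->
  \int[m]_(w in A) time_val (tau w) = \sum_(0 <= k <oo) m (t k.+1 `&` A).
Proof.
move=> mA; under eq_integral do rewrite time_val_sum.
rewrite integral_nneseries//.
- by apply: eq_eseriesr => k _; rewrite integral_indic// setIC.
- by move=> k; apply/measurable_EFinP; exact: measurable_realfun.measurable_indic.
Qed.

Lemma measurable_delay nu : measurable_fun setT (delay R tau nu : Omega -> \bar R).
Proof. by apply: emeasurable_funB; [exact: measurable_time_val|exact: measurable_cst]. Qed.

Lemma delay_ge0 nu w : t nu w -> 0 <= delay R tau nu w :> \bar R.
Proof. by move=> tw; rewrite /delay sube_ge0. Qed.

(** On {tau >= nu}, the delay counts the i >= 1 such that tau >= nu + i. *)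
Lemma integral_delay_ge (Q : probability Omega R) nu m : (1 <= nu)%N ->
  (\sum_(1 <= i < m.+1) fine (Q (t (nu + i)%N)))%:E <= \int[Q]_(w in t nu) delay R tau nu w.
Proof.
move=> nu1; have mtnu := mt nu.
have -> : (\sum_(1 <= i < m.+1) fine (Q (t (nu + i)%N)))%:E =
    \int[Q]_(w in t nu) \sum_(0 <= i < m) (\1_(t (nu + i).+1) w)%:E.
  rewrite ge0_integral_sum//; last first.
    by move=> k; apply/measurable_EFinP; exact: measurable_realfun.measurable_indic.
  rewrite big_add1/= -sumEFin; apply: eq_bigr => i _.
  rewrite integral_indic// addnS fineK ?fin_num_measure// setIidl//.
  have sub k : t (nu + k) `<=` t nu.
    by elim: k => [|k IHk]; rewrite ?addn0// addnS; apply: subset_trans IHk; exact: not_beforeS.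
  by rewrite -addnS.
apply: ge0_le_integral => //.
- by move=> x _; apply: sume_ge0 => k _; rewrite lee_fin.
- apply: emeasurable_sum => k; apply/measurable_EFinP.
  exact: measurable_realfun.measurable_indic.
- by apply: measurable_funTS; exact: measurable_delay.
move=> w; rewrite sum_indic_not_before /not_before /delay /=; case: (tau w) => [n|] /=.
  rewrite lee_fin ler_nat => nun; rewrite -EFinB lee_fin -natrB// ler_nat.
  exact: geq_minr.
by move=> _; rewrite leey.
Qed.

Lemma exists_large_tail_sum (P : probability Omega R) (b : R) : (0 < b)%R ->
  b%:E <= \int[P]_w time_val (tau w) ->
  exists N, (b / 2 < \sum_(1 <= k < N.+1) fine (P (t k)))%R.
Proof.
move=> b0; rewrite expectation_time_val// => bE; apply: contrapT => H.
suff : b%:E <= (b / 2)%:E by rewrite lee_fin; lra.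
apply: le_trans bE _; apply: lime_le.
  by apply: is_cvg_ereal_nneg_natsum => n _; exact: measure_ge0.
apply: nearW => N; rewrite leNgt; apply/negP => bN; apply: H; exists N.
rewrite -lte_fin; apply: lt_le_trans bN _; rewrite big_add1/= -sumEFin.
by apply: lee_sum => k _; rewrite setIT fineK// fin_num_measure.
Qed.

End stopping_time_expectations.

(** * Conditional expectations of the delay *)

Section past_trace.
Context {d} {E : measurableType d} {d'} {Omega : measurableType d'} {R : realType}.
Variables (X : nat -> {mfun Omega >-> E}) (Q : probability Omega R) (n : nat).
Variables (B : set Omega) (mB : measurable B).
Local Open Scope ereal_scope.

(** Its derivative with respect to the restriction of Q to the past is the
    conditional probability of B. *)
Definition past_trace of measurable B := fun A : set (past X n) => Q (A `&` B).
Local Notation m := (past_trace mB).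

Let past_measurable (A : set (past X n)) : measurable A -> d'.-measurable A.
Proof. exact: obs_filtration_measurable. Qed.

Let m0 : m set0 = 0. Proof. by rewrite /past_trace set0I measure0. Qed.

Let m_ge0 A : 0 <= m A. Proof. exact: measure_ge0. Qed.

Let m_sigma_additive : semi_sigma_additive m.
Proof.
move=> F mF tF mUF; have := @measure_semi_sigma_additive _ _ _ (mrestr Q mB) F.
by apply => // [k|]; apply: past_measurable.
Qed.

HB.instance Definition _ := isMeasure.Build _ _ _ m m0 m_ge0 m_sigma_additive.

Let m_fin : fin_num_fun m.
Proof.
move=> A mA; apply: fin_num_measure; apply: measurableI => //.
exact: past_measurable.
Qed.

HB.instance Definition _ := @Measure_isFinite.Build _ _ _ m m_fin.

End past_trace.

Section conditional_expectations.
Context {d} {E : measurableType d} {d'} {Omega : measurableType d'} {R : realType}.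
Variables (X : nat -> {mfun Omega >-> E}) (Q : probability Omega R).
Local Open Scope ereal_scope.

Lemma past_conditional_probability n B : measurable B ->
  exists h : past X n -> \bar R, [/\ measurable_fun setT h, forall w, 0 <= h w &
    forall A, obs_filtration X n A -> Q (B `&` A) = \int[Q]_(w in A) h w].
Proof.
move=> mB.
pose Y : {mfun Omega >-> past X n} :=
  HB.pack (id : Omega -> past X n)
    (isMeasurableFun.Build _ _ _ _ _ (@measurable_to_past _ _ _ _ X n)).
pose nu : {finite_measure set (past X n) -> \bar R} := @past_trace _ _ _ _ _ X Q n _ mB.
have nuQ : nu `<< distribution Q Y.
  apply/null_content_dominatesP => A mA A0.
  have mAO : d'.-measurable A by apply: (@obs_filtration_measurable _ _ _ _ X n).
  apply/eqP; rewrite eq_le measure_ge0 andbT -[leRHS]A0.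
  by apply: (@le_measure _ _ _ Q); rewrite ?inE//; exact: measurableI.
have hint := Radon_Nikodym_SigmaFinite.f_integrable nuQ.
exists (Radon_Nikodym_SigmaFinite.f nu (distribution Q Y)); split.
- exact: measurable_int hint.
- exact: Radon_Nikodym_SigmaFinite.f_ge0.
- move=> A FA; rewrite setIC -[LHS]/(nu A) (Radon_Nikodym_SigmaFinite.f_integral nuQ FA).
  rewrite ge0_integral_pushforward//.
    by apply: measurable_funTS; exact: measurable_int hint.
  by move=> w _; exact: Radon_Nikodym_SigmaFinite.f_ge0.
Qed.

Variable tau : Omega -> option nat.
Hypothesis stau : stopping_time R X tau.
Local Notation t := (not_before R tau).

(** The conditional probabilities of the events {tau >= k + 1} add up to a version of
    the conditional expectation of tau, also when tau is infinite with positive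
    probability. *)
Lemma cond_expectation_delayP n nu : is_cond_expectation Q (obs_filtration X n)
  (delay R tau nu) (cond_expectation Q (obs_filtration X n) (delay R tau nu)).
Proof.
apply: xgetPex.
have /choice[h hP] : forall k, exists h : past X n -> \bar R,
    [/\ measurable_fun setT h, forall w, 0 <= h w &
    forall A, obs_filtration X n A -> Q (t k.+1 `&` A) = \int[Q]_(w in A) h w].
  by move=> k; apply: past_conditional_probability; exact: (measurable_not_before stau).
have mh k : measurable_fun setT (h k) by case: (hP k).
have h0 k w : 0 <= h k w by case: (hP k).
pose S : past X n -> \bar R := fun w => \sum_(0 <= k <oo) h k w.
have mS : measurable_fun setT S by apply: ge0_emeasurable_sum.
have S0 w : 0 <= S w by apply: nneseries_ge0.
exists (fun w => S w - nu%:R%:E); split.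
  move=> _ [B mB <-]; apply: (emeasurable_funB mS) => //; exact: measurable_cst.
move=> A FA; have mA := obs_filtration_measurable FA.
have mSO : measurable_fun setT (S : Omega -> \bar R) by exact: measurable_fun_past mS.
have mtA : measurable_fun A (fun w => time_val (tau w) : \bar R).
  by apply: measurable_funTS; exact: (measurable_time_val stau).
have mSA : measurable_fun A (S : Omega -> \bar R) by exact: measurable_funTS.
rewrite /delay (ge0_integralB_cst Q mA mSA (fun w _ => S0 w) (ler0n _ nu)).
rewrite (ge0_integralB_cst Q mA mtA (fun w _ => time_val_ge0 tau w) (ler0n _ nu)).
congr (_ - _); rewrite (expectation_time_val stau)// integral_nneseries//.
- by apply: eq_eseriesr => k _; case: (hP k) => _ _ <-.
- move=> k; apply: measurable_funTS; exact: measurable_fun_past (mh k).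
Qed.

(** Since {tau >= nu} is an event of the past, the conditional expectation Y has the
    same integral over it as the delay, and Y is almost surely at most its essential
    supremum. *)
Lemma cond_delay_le_ess_sup nu : (1 <= nu)%N -> 0 < Q (t nu) ->
  cond_expectation_event Q (t nu) (delay R tau nu) <=
  ess_sup Q (cond_expectation Q (obs_filtration X nu.-1) (delay R tau nu)).
Proof.
move=> nu1 Qt.
have [YF YE] := cond_expectation_delayP nu.-1 nu.
set Y := cond_expectation _ _ _ in YF YE *.
have tF : obs_filtration X nu.-1 (t nu).
  exact: (not_before_pred_obs stau).
have mt := obs_filtration_measurable tF.
have mY : measurable_fun setT Y.
  by move=> _ B mB; apply: (@obs_filtration_measurable _ _ _ _ X nu.-1); apply: YF; exists B.
have Qfin : Q (t nu) \is a fin_num by exact: fin_num_measure.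
have YZ := YE _ tF.
have Y0 : 0 <= \int[Q]_(w in t nu) Y w.
  by rewrite YZ; apply: integral_ge0 => w; exact: delay_ge0.
have Yle r : {ae Q, forall w, Y w <= r%:E} ->
    \int[Q]_(w in t nu) Y w <= r%:E * Q (t nu).
  by move=> Yr; exact: (ae_le_integral_cst mt mY Yr Y0).
have QE : Q (t nu) = (fine (Q (t nu)))%:E by rewrite fineK.
have Q0 : (0 < fine (Q (t nu)))%R by rewrite -lte_fin -QE.
rewrite /cond_expectation_event -YZ QE inver gt_eqF//.
have := @ess_sup_ge _ _ _ Q Y.
case: (ess_sup Q Y) => [r||] Ysup.
- by rewrite lee_pdivrMr// -QE; exact: Yle.
- by rewrite leey.
(* If Y were -oo almost surely, its integral over this event would be negative. *)
- have : \int[Q]_(w in t nu) Y w <= (-1)%:E * Q (t nu).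
    by apply: Yle; apply: filterS Ysup => w; rewrite leeNy_eq => /eqP ->; exact: leNye.
  move=> /(le_trans Y0); rewrite EFinN mulN1e leeNr oppe0 leNgt.
  by rewrite Qt.
Qed.

End conditional_expectations.

Section worst_case_delays.
Context {d} {E : measurableType d} {d'} {Omega : measurableType d'} {R : realType}.
Variables (X : nat -> {mfun Omega >-> E}) (P : nat -> probability Omega R).
Variable tau : Omega -> option nat.
Hypothesis stau : stopping_time R X tau.
Local Open Scope ereal_scope.

Lemma worst_cond_delay_le : worst_cond_delay P tau <= worst_ess_sup_delay X P tau.
Proof.
apply: ge_ereal_sup => _ [nu [nu1 Pt] <-].
apply: (le_trans (cond_delay_le_ess_sup (Q := P nu) stau nu1 Pt)).
by apply: ereal_sup_ubound; exists nu.
Qed.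

Lemma worst_cond_delay_ge nu (x : R) : (1 <= nu)%N -> 0 < P nu (not_before R tau nu) ->
  x%:E * P nu (not_before R tau nu) <=
    \int[P nu]_(w in not_before R tau nu) delay R tau nu w ->
  x%:E <= worst_cond_delay P tau.
Proof.
move=> nu1 Pt xP.
have PE : P nu (not_before R tau nu) = (fine (P nu (not_before R tau nu)))%:E.
  by rewrite fineK//; apply: fin_num_measure; exact: (measurable_not_before stau).
have P0 : (0 < fine (P nu (not_before R tau nu)))%R by rewrite -lte_fin -PE.
apply: (@le_trans _ _ (cond_expectation_event (P nu) (not_before R tau nu) (delay R tau nu))).
  by rewrite /cond_expectation_event PE inver gt_eqF// lee_pdivlMr// -PE.
by apply: ereal_sup_ubound; exists nu.
Qed.

End worst_case_delays.

(** * The lower bound *)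

Section tail_probabilities.
Context {d} {E : measurableType d} {d'} {Omega : measurableType d'} {R : realType}.
Variables (X : nat -> {mfun Omega >-> E}) (tau : Omega -> option nat).
Hypothesis stau : stopping_time R X tau.
Variable Q : probability Omega R.
Local Notation q k := (fine (Q (not_before R tau k))).

Lemma tail_probability_le k : q k.+1 <= q k.
Proof.
have mt j : measurable (not_before R tau j) by exact: (measurable_not_before stau).
apply: fine_le; [exact: fin_num_measure..|apply: le_measure; rewrite ?inE//].
exact: not_beforeS.
Qed.

Lemma tail_probability_ge0 k : 0 <= q k.
Proof. exact: fine_ge0. Qed.

Lemma tail_probability_le1 k : q k <= 1.
Proof.
elim: k => [|k IHk]; last exact: le_trans (tail_probability_le k) IHk.
by rewrite not_before0 probability_setT.
Qed.

End tail_probabilities.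

Section periodic_information.
Context {d} {E : measurableType d} {R : realType}.
Variables (mu : {sigma_finite_measure set E -> \bar R}) (T : nat) (f g : nat -> E -> R).
Hypothesis hT : (1 <= T)%N.
Hypotheses (hf : forall n, (1 <= n)%N -> is_density mu (f n))
           (hg : forall n, (1 <= n)%N -> is_density mu (g n)).
Hypotheses (hfT : periodic_from1 T f) (hgT : periodic_from1 T g).
Hypothesis I_fin : (info_rate mu T f g < +oo)%E.

(** The terms of the rate are nonnegative, so an infinite one would make it infinite;
    periodicity takes care of the times after the first period. *)
Lemma KL_fin n : (1 <= n)%N -> (KL mu (g n) (f n) < +oo)%E.
Proof.
have KL0 i : (1 <= i)%N -> (0 <= KL mu (g i) (f i))%E.
  by move=> i1; exact: KL_ge0 (hf i1) (hg i1).
have [N nN] := ubnP n; elim: N n nN => // N IHN n nN n1.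
have [nT|Tn] := leqP n T; last first.
  have nE : n = (n - T + T)%N by rewrite subnK// ltnW.
  rewrite nE hfT ?hgT ?subn_gt0//; apply: IHN; rewrite ?subn_gt0//.
  by rewrite -ltnS (leq_trans _ nN)// ltnS ltn_subrL n1 hT.
rewrite ltNge leye_eq; apply/negP => /eqP KLoo.
move: I_fin; rewrite /info_rate (bigD1_seq n) ?iota_uniq ?mem_index_iota ?n1//=.
rewrite KLoo addye ?gt0_muley ?ltxx// ?lte_fin ?invr_gt0 ?ltr0n//.
rewrite gt_eqF// (lt_le_trans (ltNyr 0))// big_seq_cond sume_ge0// => i.
by rewrite mem_index_iota => /andP[/andP[i1 _] _]; exact: KL0.
Qed.

Lemma sum_KL : \sum_(1 <= k < T.+1) fine (KL mu (g k) (f k)) =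
  T%:R * fine (info_rate mu T f g).
Proof.
rewrite /info_rate.
have -> : (\sum_(1 <= i < T.+1) KL mu (g i) (f i))%E =
    (\sum_(1 <= k < T.+1) fine (KL mu (g k) (f k)))%:E.
  rewrite -sumEFin; apply: eq_big_nat => i /andP[i1 _].
  by rewrite fineK// ge0_fin_numE ?KL_fin// KL_ge0//; [exact: hf|exact: hg].
by rewrite -EFinM /= mulrA divff ?mul1r// pnatr_eq0 -lt0n.
Qed.

End periodic_information.

Theorem theorem3p1 (R : realType)
  (d : measure_display) (E : measurableType d)
  (mu : {sigma_finite_measure set E -> \bar R})
  (T : nat) (hT : (1 <= T)%N)
  (f g : nat -> E -> R)
  (hf : forall n, (1 <= n)%N -> is_density mu (f n))
  (hg : forall n, (1 <= n)%N -> is_density mu (g n))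
  (hfT : periodic_from1 T f) (hgT : periodic_from1 T g)
  (I_gt0 : (0 < info_rate mu T f g)%E)
  (I_fin : (info_rate mu T f g < +oo)%E)
  (d' : measure_display) (Omega : measurableType d')
  (X : nat -> {mfun Omega >-> E})
  (Pinf : probability Omega R) (P : nat -> probability Omega R)
  (hP : change_point_model mu X f g Pinf P) :
  exists o : R -> R,
    o b @[b --> +oo] --> (0 : R) /\
    forall (b : R) (tau : Omega -> option nat),
      0 < b -> stopping_time R X tau ->
      (b%:E <= \int[Pinf]_w time_val (tau w))%E ->
      (worst_cond_delay P tau <= worst_ess_sup_delay X P tau)%E /\
      ((ln b / fine (info_rate mu T f g) * (1 + o b))%:E
         <= worst_cond_delay P tau)%E.
Proof.
set I := fine (info_rate mu T f g).
have I0 : 0 < I by rewrite fine_gt0// I_gt0 I_fin.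
have klfin := KL_fin hT hf hg hfT hgT I_fin.
exists (rate_error I (T%:R * (1 + I))); split; first exact: rate_error_cvg0.
move=> b tau b0 stau bE; split; first exact: worst_cond_delay_le.
pose p k := fine (Pinf (not_before R tau k)).
have pmono : nonincreasing_seq p.
  by apply/nonincreasing_seqP => k; exact: tail_probability_le stau _ _.
have p0 k : 0 <= p k by exact: tail_probability_ge0.
have p01 k : 0 <= p k <= 1 by rewrite p0; exact: tail_probability_le1 stau _ _.
have [N bN] := exists_large_tail_sum stau b0 bE.
have pQ nu : (1 <= nu)%N -> P nu (not_before R tau nu) = Pinf (not_before R tau nu).
  move=> nu1; apply: (eq_before_change hP nu1 (n := nu.-1)); first by rewrite prednK.
  exact: (not_before_pred_obs stau).
have Ppos nu : (1 <= nu)%N -> 0 < p nu -> (0 < P nu (not_before R tau nu))%E.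
  move=> nu1; rewrite pQ// /p => pnu; rewrite -[X in (_ < X)%E]fineK ?lte_fin//.
  by apply: fin_num_measure; exact: (measurable_not_before stau).
have [y4|y4] := ltrP (Num.sqrt (ln b)) 4.
  (* The bound to be proved is 0: any time that tau reaches with positive
     probability will do. *)
  rewrite /rate_error y4 subrr mulr0.
  have [nu [nu1 pnu _]] := exists_slow_decay (ltn0Sn 0) b0 p01 pmono bN.
  apply: (worst_cond_delay_ge stau nu1 (Ppos _ nu1 pnu)).
  by rewrite mul0e; apply: integral_ge0 => w; exact: delay_ge0.
rewrite rate_errorE//; set y := Num.sqrt (ln b) in y4 *.
have y0 : 0 < y by apply: lt_le_trans y4.
have bexp : b = expR (y ^+ 2).
  rewrite sqr_sqrtr ?lnK ?posrE// leNgt; apply/negP => /ltW /ler0_sqrtr lb.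
  by move: y4; rewrite /y lb; lra.
have y30 : 0 <= y ^+ 3 by rewrite exprn_ge0// ltW.
(* The length of the window has to be large compared with y^2 and small compared
   with exp (4 y). *)
pose m := (Num.truncn (y ^+ 3)).+1.
have ym : y ^+ 3 <= m%:R by rewrite ltW// truncnS_gt.
have my : m%:R <= y ^+ 3 + 1.
  by rewrite -natr1 lerD2r truncn_le.
have M0 : (0 < T * m)%N by rewrite muln_gt0 hT.
have [nu [nu1 pnu slow]] := exists_slow_decay M0 b0 p01 pmono bN.
pose q k := fine (P nu (not_before R tau k)).
have qmono : nonincreasing_seq q.
  by apply/nonincreasing_seqP => k; exact: tail_probability_le stau _ _.
have q0 k : 0 <= q k by exact: tail_probability_ge0.
have qp : q nu = p nu by rewrite /q pQ.
pose s := \sum_(1 <= i < (T * m).+1) q (nu + i)%N.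
have s0 : 0 <= s by rewrite sumr_ge0.
have sq : (T * m)%:R * q (nu + T * m)%N <= s.
  have := @sum_nonincreasing_ge _ q nu 1 (T * m).+1 (nu + T * m) qmono.
  by rewrite subn1 addnS; exact.
have info := stopped_information_ge hf hg hP klfin nu1 stau (T * m) (y ^+ 2 - 4 * y).
have D0 n : (1 <= n)%N -> 0 <= fine (KL mu (g n) (f n)).
  by move=> n1; rewrite fine_ge0// KL_ge0//; [exact: hf|exact: hg].
have DT n : (1 <= n)%N -> fine (KL mu (g (n + T)%N) (f (n + T)%N)) = fine (KL mu (g n) (f n)).
  by move=> n1; rewrite hfT// hgT.
have upper := periodic_sum_le m DT D0 (sum_KL hT hf hg hfT hgT I_fin) (ltW I0) q0 qmono nu1.
have key : (y ^+ 2 - 4 * y - T%:R * (1 + I)) * q nu <= s * (I + y^-1).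
  apply: (@delay_arith _ I y (q nu) s (q (nu + T * m)%N) (p (nu + T * m)%N) _ T m) => //.
  - by rewrite qp.
  - by rewrite p0 qp; apply: pmono; exact: leq_addr.
  - by rewrite -bexp qp.
  - by apply: le_trans upper; move: info; rewrite -/(q _) -/(p _) -qp.
have Iy : 0 < I + y^-1 by rewrite addr_gt0// invr_gt0.
apply: (worst_cond_delay_ge stau nu1 (Ppos _ nu1 pnu)).
apply: le_trans (integral_delay_ge stau (P nu) (T * m) nu1).
rewrite -[X in (_ * X)%E]fineK; last first.
  by apply: fin_num_measure; exact: (measurable_not_before stau).
rewrite -EFinM lee_fin mulrAC ler_pdivrMr//.
Qed.
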